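(* Let $\Omega\subseteq\mathbb H$ be an axially symmetric open set, $f$ a left slice hyperholomorphic function on $\Omega$, and $p\in\mathbb H$. Assume that $f$ admits the $*$-Laurent expansion $$f(q)=\sum_{n=0}^\infty(q-p)^{*n}a_n+\sum_{n=1}^\infty(q-p)^{-*n}a_{-n},\qquad\{a_n\}_{n\in\mathbb Z}\subset\mathbb H,$$ convergent absolutely and uniformly on the compact subsets of $\Omega(p,R_1,R_2)\subseteq\Omega$, assumed nonempty, where $\frac1{R_2}=\limsup_{n\to\infty}|a_n|^{1/n}$, $R_1=\limsup_{n\to\infty}|a_{-n}|^{1/n}$ and $0<R_1<R_2$. Then, for $q\in\Omega(p,R_1,R_2)$, $$Df(q)=\sum_{n=0}^\infty\widetilde H_n(q,p)b_n+\sum_{n=1}^\infty\mathcal H_n(q,p)\,\mathcal Q_{c,p}^{-n}(q)\,b_{-n},$$ where $b_n=-2(n+1)a_{n+1}$ for $n\ge0$ and $b_{-n}=2a_{-n}$ for $n\ge1$.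
   Context: $\mathbb H$ denotes the quaternions $q=q_0+q_1e_1+q_2e_2+q_3e_3$ with the usual relations ($e_i^2=-1$, $e_1e_2=-e_2e_1=e_3$, $e_2e_3=-e_3e_2=e_1$, $e_3e_1=-e_1e_3=e_2$), $\underline q=q_1e_1+q_2e_2+q_3e_3$, $\bar q=q_0-\underline q$, $\mathbb S=\{\underline q:|\underline q|=1\}$, $\mathbb C_I=\mathbb R+I\mathbb R$ for $I\in\mathbb S$, $[q]=\{q_0+I|\underline q|:I\in\mathbb S\}$; a set $U$ is axially symmetric if $[q]\subset U$ for all $q\in U$. Slice hyperholomorphic: for $U$ axially symmetric open and $\mathcal U=\{(u,v)\in\mathbb R^2:u+\mathbb Sv\subset U\}$, $f:U\to\mathbb H$ is left slice hyperholomorphic if $f(u+Iv)=\alpha(u,v)+I\beta(u,v)$ for all $(u,v)\in\mathcal U$, $I\in\mathbb S$, with $C^1$ functions $\alpha,\beta:\mathcal U\to\mathbb H$, $\alpha$ even and $\beta$ odd in $v$, satisfying $\partial_u\alpha=\partial_v\beta$, $\partial_v\alpha=-\partial_u\beta$. $D=\partial_{q_0}+e_1\partial_{q_1}+e_2\partial_{q_2}+e_3\partial_{q_3}$ acting from the left, in $q$. $\Omega(p,R_1,R_2)$: choose $I\in\mathbb S$ with $p\in\mathbb C_I$, let $S_I(p,R_1,R_2)=\{z\in\mathbb C_I:R_1<|z-p|<R_2\}$; then $\Omega(p,R_1,R_2)=\{x+yJ:J\in\mathbb S,\ x,y\in\mathbb R,\ x+yI\text{ and }x-yI\in S_I(p,R_1,R_2)\}$.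 $*$-powers and products (left $*$-product in $q$): $(q-p)^{*m}=\sum_{i=0}^m\binom mi q^i(-p)^{m-i}$, $(\bar q-p)^{*k}=\sum_{j=0}^k\binom kj\bar q^j(-p)^{k-j}$, $(q-p)^{*m}*(\bar q-p)^{*k}=(\bar q-p)^{*k}*(q-p)^{*m}=\sum_{i=0}^m\sum_{j=0}^k\binom mi\binom kj q^i\bar q^j(-p)^{m-i+k-j}$; and for $q\notin[p]$, $n\ge1$, $(q-p)^{-*n}=(q^2-2p_0q+|p|^2)^{-n}(q-\bar p)^{*n}$ with $p_0=\mathrm{Re}(p)$. $\widetilde H_n(q,p)=\frac1{n+1}\sum_{k=1}^{n+1}(q-p)^{*(n+1-k)}*(\bar q-p)^{*(k-1)}$ ($n\ge0$); $\mathcal H_n(q,p)=\sum_{k=1}^n(\bar q-p)^{*(n-k)}*(q-p)^{*(k-1)}$ ($n\ge1$); $\mathcal Q_{c,p}^{-n}(q)=(p^2-2q_0p+|q|^2)^{-n}$. *)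

(* Defs.v *)
From HB Require Import structures.
From mathcomp Require Import all_boot all_order all_algebra.
From mathcomp Require Import ring lra.
From mathcomp Require Import all_classical all_reals all_analysis.

Set Implicit Arguments.
Unset Strict Implicit.
Unset Printing Implicit Defensive.

Import Order.TTheory GRing.Theory Num.Theory.
Import numFieldNormedType.Exports.

Local Open Scope classical_set_scope.
Local Open Scope ring_scope.

(* A quaternion is the row of its four real coordinates; the topology and the
   real vector space structure are those of 'rV[R]_4.  Note that `|q| is then
   the maximum norm of R^4; the Euclidean modulus is qabs. *)
Definition quat (R : realType) := 'rV[R]_4.

HB.instance Definition _ (R : realType) :=
  NormedModule.copy (quat R) 'rV[R]_4.
HB.instance Definition _ (R : realType) :=
  Complete.copy (quat R) 'rV[R]_4.

Section QuaternionAlgebra.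
Context {R : realType}.
Implicit Types p q r : quat R.

Definition mkquat (a b c d : R) : quat R := \row_j [:: a; b; c; d]`_j.

Definition qbasis (i : 'I_4) : quat R := delta_mx 0 i.

Definition qone : quat R := qbasis 0.

Definition qmul p q : quat R := mkquat
  (p 0 0 * q 0 0 - p 0 1 * q 0 1 - p 0 2 * q 0 2 - p 0 3 * q 0 3)
  (p 0 0 * q 0 1 + p 0 1 * q 0 0 + p 0 2 * q 0 3 - p 0 3 * q 0 2)
  (p 0 0 * q 0 2 - p 0 1 * q 0 3 + p 0 2 * q 0 0 + p 0 3 * q 0 1)
  (p 0 0 * q 0 3 + p 0 1 * q 0 2 - p 0 2 * q 0 1 + p 0 3 * q 0 0).

Definition qconj q : quat R :=
  mkquat (q 0 0) (- q 0 1) (- q 0 2) (- q 0 3).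

Definition qre q : R := q 0 0.

Definition qim q : quat R := mkquat 0 (q 0 1) (q 0 2) (q 0 3).

Definition qsqnorm q : R := \sum_(i < 4) q 0 i ^+ 2.

Definition qabs q : R := Num.sqrt (qsqnorm q).

Definition qinv q : quat R := (qsqnorm q)^-1 *: qconj q.

Lemma quatP p q : [/\ p 0 0 = q 0 0, p 0 1 = q 0 1, p 0 2 = q 0 2 &
  p 0 3 = q 0 3] -> p = q.
Proof.
move=> [h0 h1 h2 h3]; apply/rowP => -[[|[|[|[|//]]]] hi].
- by rewrite (_ : Ordinal hi = 0) //; apply: val_inj.
- by rewrite (_ : Ordinal hi = 1) //; apply: val_inj.
- by rewrite (_ : Ordinal hi = 2) //; apply: val_inj.
- by rewrite (_ : Ordinal hi = 3) //; apply: val_inj.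
Qed.

Lemma qsqnormE q :
  qsqnorm q = q 0 0 ^+ 2 + q 0 1 ^+ 2 + q 0 2 ^+ 2 + q 0 3 ^+ 2.
Proof.
rewrite /qsqnorm !big_ord_recr big_ord0 /= add0r.
by do ![congr (_ + _)]; congr (q _ _ ^+ 2); apply: val_inj.
Qed.

Lemma qmulA : associative qmul.
Proof. by move=> p q r; apply: quatP; split; rewrite !mxE /=; ring. Qed.

Lemma qmul1q : left_id qone qmul.
Proof. by move=> q; apply: quatP; split; rewrite !mxE /=; ring. Qed.

Lemma qmulq1 : right_id qone qmul.
Proof. by move=> q; apply: quatP; split; rewrite !mxE /=; ring. Qed.

Lemma qmulDl : left_distributive qmul +%R.
Proof. by move=> p q r; apply: quatP; split; rewrite !mxE /=; ring. Qed.

Lemma qmulDr : right_distributive qmul +%R.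
Proof. by move=> p q r; apply: quatP; split; rewrite !mxE /=; ring. Qed.

Lemma qone_neq0 : qone != 0.
Proof.
by apply/eqP => /(congr1 (fun q : quat R => q 0 0)) /eqP; rewrite !mxE oner_eq0.
Qed.

HB.instance Definition _ := GRing.Zmodule_isNzRing.Build (quat R)
  qmulA qmul1q qmulq1 qmulDl qmulDr qone_neq0.

Lemma qscaleAl (a : R) p q : a *: (p * q) = (a *: p) * q.
Proof. by apply: quatP; split; rewrite !mxE /=; ring. Qed.

HB.instance Definition _ := GRing.Lmodule_isLalgebra.Build R (quat R) qscaleAl.

Lemma qscaleAr (a : R) p q : a *: (p * q) = p * (a *: q).
Proof. by apply: quatP; split; rewrite !mxE /=; ring. Qed.

HB.instance Definition _ := GRing.Lalgebra_isAlgebra.Build R (quat R) qscaleAr.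

Lemma qsqnorm_eq0 q : (qsqnorm q == 0) = (q == 0).
Proof.
rewrite qsqnormE; apply/eqP/eqP => [h|->]; last by rewrite !mxE; ring.
have h0 := sqr_ge0 (q 0 0); have h1 := sqr_ge0 (q 0 1).
have h2 := sqr_ge0 (q 0 2); have h3 := sqr_ge0 (q 0 3).
apply: quatP; rewrite !mxE.
by split; apply/eqP; rewrite -sqrf_eq0; apply/eqP; lra.
Qed.

Lemma qmul_conj q : q * qconj q = (qsqnorm q)%:A.
Proof. by rewrite qsqnormE; apply: quatP; split; rewrite !mxE /=; ring. Qed.

Lemma qconj_mul q : qconj q * q = (qsqnorm q)%:A.
Proof. by rewrite qsqnormE; apply: quatP; split; rewrite !mxE /=; ring. Qed.

Lemma qmulVq : {in [pred q : quat R | q != 0], left_inverse 1 qinv *%R}.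
Proof.
move=> q; rewrite inE -qsqnorm_eq0 => q0.
by rewrite /qinv -qscaleAl qconj_mul scalerA mulVf // scale1r.
Qed.

Lemma qmulqV : {in [pred q : quat R | q != 0], right_inverse 1 qinv *%R}.
Proof.
move=> q; rewrite inE -qsqnorm_eq0 => q0.
by rewrite /qinv -qscaleAr qmul_conj scalerA mulVf // scale1r.
Qed.

Lemma quat_unitP p q : q * p = 1 /\ p * q = 1 -> p != 0.
Proof.
move=> [+ _]; apply: contra_eqN => /eqP ->.
by rewrite mulr0 eq_sym oner_eq0.
Qed.

Lemma qinv_out : {in [predC [pred q : quat R | q != 0]], qinv =1 id}.
Proof.
move=> q; rewrite !inE negbK => /eqP ->; apply: quatP.
by rewrite /qinv; split; rewrite !mxE /=; ring.
Qed.

HB.instance Definition _ := GRing.NzRing_hasMulInverse.Build (quat R)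
  qmulVq qmulqV quat_unitP qinv_out.

End QuaternionAlgebra.

Section SliceHyperholomorphic.
Context {R : realType}.
Implicit Types (p q I J : quat R) (U : set (quat R)) (f : quat R -> quat R).

Definition imag_sphere : set (quat R) := [set I | qre I = 0 /\ qabs I = 1].

Definition sphere_of q : set (quat R) :=
  [set (qre q)%:A + qabs (qim q) *: I | I in imag_sphere].

Definition axially_symmetric U := forall q, U q -> sphere_of q `<=` U.

Definition complex_plane I : set (quat R) :=
  [set z | exists x y : R, z = x%:A + y *: I].

Definition slice_domain U : set (R * R) :=
  [set z | forall I, imag_sphere I -> U (z.1%:A + z.2 *: I)].

Definition partial_u (g : R * R -> quat R) : R * R -> quat R :=
  fun z => 'D_((1, 0) : R * R) g z.
Definition partial_v (g : R * R -> quat R) : R * R -> quat R :=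
  fun z => 'D_((0, 1) : R * R) g z.

(* Only used on the open sets V = slice_domain U, U open. *)
Definition C1_on (V : set (R * R)) (g : R * R -> quat R) :=
  forall z, V z ->
    [/\ derivable g z ((1, 0) : R * R), derivable g z ((0, 1) : R * R),
        {for z, continuous (partial_u g)} & {for z, continuous (partial_v g)}].

Definition left_slice_hyperholomorphic U f :=
  exists alpha beta : R * R -> quat R,
    [/\ C1_on (slice_domain U) alpha, C1_on (slice_domain U) beta &
        forall u v, slice_domain U (u, v) ->
          [/\ forall I, imag_sphere I ->
                f (u%:A + v *: I) = alpha (u, v) + I * beta (u, v),
              alpha (u, - v) = alpha (u, v),
              beta (u, - v) = - beta (u, v),
              partial_u alpha (u, v) = partial_v beta (u, v) &
              partial_v alpha (u, v) = - partial_u beta (u, v)]].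

Definition fueter_derivable f q :=
  forall i : 'I_4, derivable f q (qbasis i).

(* D = d/dq_0 + e_1 d/dq_1 + e_2 d/dq_2 + e_3 d/dq_3 acting from the left,
   where qbasis 0 = 1; 'D_v is a junk value where f is not derivable. *)
Definition fueter f q : quat R :=
  \sum_(i < 4) qbasis i * 'D_(qbasis i) f q.

End SliceHyperholomorphic.

Section StarPowers.
Context {R : realType}.
Implicit Types (p q : quat R) (m n k : nat).

(* (q - p)^{*m} *)
Definition starX q p m : quat R :=
  \sum_(i < m.+1) (q ^+ i * (- p) ^+ (m - i)) *+ 'C(m, i).

(* (q - p)^{*m} * (conj q - p)^{*k}, equal to
   (conj q - p)^{*k} * (q - p)^{*m} *)
Definition starXconj q p m k : quat R :=
  \sum_(i < m.+1) \sum_(j < k.+1)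
    (q ^+ i * qconj q ^+ j * (- p) ^+ (m - i + (k - j))) *+ ('C(m, i) * 'C(k, j)).

(* (q - p)^{-*n}, for q outside sphere_of p and n >= 1 *)
Definition starV q p n : quat R :=
  (q ^+ 2 - (2 * qre p) *: q + (qabs p ^+ 2)%:A) ^- n * starX q (qconj p) n.

(* \widetilde H_n *)
Definition Htilde n q p : quat R :=
  n.+1%:R^-1 *: \sum_(1 <= k < n.+2) starXconj q p (n.+1 - k) (k - 1).

(* \mathcal H_n *)
Definition Hcal n q p : quat R :=
  \sum_(1 <= k < n.+1) starXconj q p (k - 1) (n - k).

(* \mathcal Q_{c,p}^{-n}(q) *)
Definition QcV p n q : quat R :=
  (p ^+ 2 - (2 * qre q) *: p + (qabs q ^+ 2)%:A) ^- n.

End StarPowers.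

Section LaurentShell.
Context {R : realType}.
Implicit Types (p q z I J : quat R) (A : set (quat R)).

Definition slice_annulus I p (R1 R2 : \bar R) : set (quat R) :=
  [set z | complex_plane I z /\
           (R1 < (qabs (z - p))%:E)%E /\ ((qabs (z - p))%:E < R2)%E].

(* The set does not depend on the choice of I (unique up to sign when p is not
   real, arbitrary when p is real). *)
Definition Omega_shell p (R1 R2 : \bar R) : set (quat R) :=
  [set q | exists I, [/\ imag_sphere I, complex_plane I p &
     exists J (x y : R), [/\ imag_sphere J,
       slice_annulus I p R1 R2 (x%:A + y *: I),
       slice_annulus I p R1 R2 (x%:A - y *: I) &
       q = x%:A + y *: J]]].

(* limsup_n |c n|^{1/n}; the term n = 0 is irrelevant *)
Definition root_limsup (c : nat -> quat R) : \bar R :=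
  limn_esup (fun n => (qabs (c n) `^ (n%:R^-1))%:E).

Definition partial_sum (m : nat) (u : nat -> quat R) : nat -> quat R :=
  fun N => \sum_(m <= n < N) u n.

(* Sum of the u n over n >= m, a junk value when the series diverges. *)
Definition series_sum (m : nat) (u : nat -> quat R) : quat R :=
  limn (partial_sum m u).

Definition cvg_abs_unif_on_compacts (m : nat)
    (u : nat -> quat R -> quat R) A :=
  forall K : set (quat R), compact K -> K `<=` A ->
    (forall q, K q -> cvgn (fun N => \sum_(m <= n < N) qabs (u n q))) /\
    {uniform K, (fun N q => partial_sum m (u ^~ q) N) @ \oo -->
                (fun q => series_sum m (u ^~ q))}.

End LaurentShell.

(* Main.v *)
(* Off the real axis the Fueter operator is algebraic on a left slice
   hyperholomorphic [f]: the Cauchy-Riemann equations give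
   [(q - conj q) * D f q = -2 (f q - f (conj q))].  The shell is stable under
   conjugation, so it suffices to subtract the two Laurent series and to divide
   each term by [q - conj q].  The operators [X = L_q - R_p] and
   [Y = L_(conj q) - R_p], with [L], [R] the left and right multiplications,
   commute; [(q - p)^{*n} = X^n 1] for all integers [n],
   [X - Y = L_(q - conj q)], [X Y = R_(Q_{c,p}(q))], and the terms of the two
   series are the telescoping factorisations of [X^n - Y^n] and
   [X^-n - Y^-n].  At a real point [x], [D f x = -2 f' x], where [f'] is the
   derivative along the real axis, and the Laurent series, whose terms are now
   honest powers of [x - p], is differentiated termwise. *)

Require Import Defs.
From mathcomp Require Import all_boot all_order all_algebra.
From mathcomp Require Import all_classical all_reals all_analysis.
From mathcomp Require Import ring.

Import Order.TTheory GRing.Theory Num.Theory.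
Import numFieldNormedType.Exports.

Local Open Scope classical_set_scope.
Local Open Scope ring_scope.

(** The factor [x - y] is put last because matrices act on rows from the right: the last factor acts
    last, and will become the outermost left multiplication, by [q - qconj q]. *)
Lemma subrXX_commr (S : nzRingType) (x y : S) n : GRing.comm x y ->
  x ^+ n - y ^+ n = (\sum_(i < n) x ^+ (n.-1 - i) * y ^+ i) * (x - y).
Proof.
move=> cxy; rewrite subrXX_comm //.
suff : GRing.comm (x - y) (\sum_(i < n) x ^+ (n.-1 - i) * y ^+ i) by [].
apply: commr_sum => i _; apply: commrM; apply: commrX; apply: commr_sym; apply: commrB.
all: by [exact: commr_refl|exact: cxy|exact: commr_sym].
Qed.

(** * Star powers as matrix powers *)

Section QuaternionOperators.
Context {R : realType}.
Implicit Types (p q u : quat R) (m n k : nat).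

(* Quaternions are rows, so left and right multiplications are matrices acting
   from the right; [(q - p)^{*n}] is then the [n]-th power of the single matrix
   [qlmx q - qrmx p] applied to [1]. *)
Definition qlmx q : 'M[R]_4 := \matrix_i (q * qbasis i).
Definition qrmx p : 'M[R]_4 := \matrix_i (qbasis i * p).

Lemma mulmx_qlmx q u : u *m qlmx q = q * u.
Proof.
rewrite mulmx_sum_row [in RHS](row_sum_delta u) mulr_sumr.
by apply: eq_bigr => i _; rewrite rowK; exact: qscaleAr.
Qed.

Lemma mulmx_qrmx p u : u *m qrmx p = u * p.
Proof.
rewrite mulmx_sum_row [in RHS](row_sum_delta u) mulr_suml.
by apply: eq_bigr => i _; rewrite rowK; exact: qscaleAl.
Qed.

Lemma eq_mulmx_quat (A B : 'M[R]_4) : (forall u, u *m A = u *m B) -> A = B.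
Proof. by move=> AB; apply/row_matrixP => i; rewrite !rowE. Qed.


Lemma qsqr_abs q : qabs q ^+ 2 = qsqnorm q.
Proof. by rewrite sqr_sqrtr // /qsqnorm sumr_ge0 // => i _; rewrite sqr_ge0. Qed.

(** The order is reversed because rows are multiplied by matrices on the right. *)
Lemma qlmxM p q : qlmx (p * q) = qlmx q * qlmx p.
Proof. by apply: eq_mulmx_quat => u; rewrite mulmxA !mulmx_qlmx mulrA. Qed.

Lemma qrmxM p q : qrmx (p * q) = qrmx p * qrmx q.
Proof. by apply: eq_mulmx_quat => u; rewrite mulmxA !mulmx_qrmx mulrA. Qed.

Lemma qlmx1 : qlmx 1 = 1.
Proof. by apply: eq_mulmx_quat => u; rewrite mulmx_qlmx mul1r mulmx1. Qed.

Lemma qrmx1 : qrmx 1 = 1.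
Proof. by apply: eq_mulmx_quat => u; rewrite mulmx_qrmx mulr1 mulmx1. Qed.

Lemma qlmxB p q : qlmx (p - q) = qlmx p - qlmx q.
Proof. by apply: eq_mulmx_quat => u; rewrite mulmxBr !mulmx_qlmx mulrBl. Qed.

Lemma qrmxN p : qrmx (- p) = - qrmx p.
Proof. by apply: eq_mulmx_quat => u; rewrite mulmxN !mulmx_qrmx mulrN. Qed.

Lemma qlmxX q n : qlmx (q ^+ n) = qlmx q ^+ n.
Proof. by elim: n => [|n IH]; rewrite ?qlmx1 // exprSr qlmxM IH -exprS. Qed.

Lemma qrmxX q n : qrmx (q ^+ n) = qrmx q ^+ n.
Proof. by elim: n => [|n IH]; rewrite ?qrmx1 // exprS qrmxM IH -exprS. Qed.

Lemma qlmx_unit q : q != 0 -> qlmx q \is a GRing.unit.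
Proof.
move=> q0; apply/unitrP; exists (qlmx q^-1).
by rewrite -!qlmxM divrr ?mulVr // qlmx1.
Qed.

Lemma qlmxV q : q != 0 -> qlmx q^-1 = (qlmx q)^-1.
Proof.
move=> q0; apply: (mulIr (qlmx_unit _ q0)).
by rewrite mulVr ?qlmx_unit // -qlmxM divrr // qlmx1.
Qed.

Lemma qrmxV q : q != 0 -> qrmx q^-1 = (qrmx q)^-1.
Proof.
move=> q0; have u : qrmx q \is a GRing.unit.
  by apply/unitrP; exists (qrmx q^-1); rewrite -!qrmxM divrr ?mulVr // qrmx1.
by apply: (mulIr u); rewrite mulVr // -qrmxM mulVr // qrmx1.
Qed.

Lemma qlmx_qrmx_comm q p : GRing.comm (qlmx q) (qrmx p).
Proof.
apply: eq_mulmx_quat => u.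
by rewrite !mulmxA !(mulmx_qlmx, mulmx_qrmx) mulrA.
Qed.

Lemma qconj_comm q : GRing.comm q (qconj q).
Proof. by rewrite /GRing.comm [LHS]qmul_conj [RHS]qconj_mul. Qed.

(** This is the operator [X = L_q - R_p]; the operator [Y] is [starmx (qconj q) p]. *)
Definition starmx q p := qlmx q - qrmx p.

Lemma mulmx_starmx u q p : u *m starmx q p = q * u - u * p.
Proof. by rewrite mulmxBr mulmx_qlmx mulmx_qrmx. Qed.

Lemma starmxX q p n :
  starmx q p ^+ n =
  \sum_(i < n.+1) qrmx ((- p) ^+ (n - i)) * qlmx (q ^+ i) *+ 'C(n, i).
Proof.
rewrite /starmx -qrmxN addrC exprDn_comm; last exact/commr_sym/qlmx_qrmx_comm.
by apply: eq_bigr => i _; rewrite qrmxX qlmxX.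
Qed.

(** Left and right multiplications commute, so this is the binomial theorem. The row [u] is
    arbitrary so that a second star power can be applied to each term of a first one. *)
Lemma mulmx_starmxX u q p n : u *m (starmx q p ^+ n) =
  \sum_(i < n.+1) (q ^+ i * u * (- p) ^+ (n - i)) *+ 'C(n, i).
Proof.
rewrite starmxX mulmx_sumr; apply: eq_bigr => i _.
by rewrite raddfMn /= mulmxA mulmx_qlmx mulmx_qrmx mulrA.
Qed.

Lemma starXE q p n : starX q p n = (1 : quat R) *m (starmx q p ^+ n).
Proof. by rewrite mulmx_starmxX; apply: eq_bigr => i _; rewrite mulr1. Qed.

(** Applying [Y^k] to a term [q^i (-p)^(m-i)] of [X^m 1] puts powers of [qconj q] on the far left
    and powers of [- p] on the far right. Since [q] and [qconj q] commute, the order of the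
    definition can be restored. *)
Lemma starXconjE q p m k : starXconj q p m k =
  (1 : quat R) *m (starmx q p ^+ m * starmx (qconj q) p ^+ k).
Proof.
rewrite mulmxA -starXE mulmx_suml; apply: eq_bigr => i _.
rewrite mulmx_starmxX; apply: eq_bigr => j _.
rewrite mulrnAr mulrnAl -mulrnA; congr (_ *+ _).
rewrite mulrA -(mulrA _ _ ((- p) ^+ (k - j))) -exprD.
by rewrite (commrX _ (commr_sym (commrX _ (commr_sym (qconj_comm q))))).
Qed.

(* [qmin p q] is the real polynomial vanishing on the sphere [[p]], evaluated at
   [q]; with the roles exchanged, [qmin q p] is the inverse of
   [\mathcal Q_{c,p}^{-1}(q)]. *)
Definition qmin p q : quat R :=
  q ^+ 2 - (2 * qre p) *: q + (qabs p ^+ 2)%:A.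

Lemma qadd_conj p : p + qconj p = (2 * qre p)%:A.
Proof. by apply: quatP; split; rewrite /qre !mxE /=; ring. Qed.

(** Expanding the product leaves right multiplications by [p + qconj p] and [p * qconj p] only. Both
    are real, so they may be moved to the left. *)
Lemma qlmx_qmin p q : qlmx (qmin p q) = starmx q p * starmx q (qconj p).
Proof.
apply: eq_mulmx_quat => u; rewrite mulmxA !mulmx_starmx mulmx_qlmx.
rewrite /qmin qsqr_abs mulrDl mulrBl mulr_algl -scalerAl -[_ *: (q * u)]mulr_algr.
rewrite -qadd_conj -[_ *: u]mulr_algr -qmul_conj expr2.
by rewrite mulrBr mulrBl mulrDr !mulrA !opprD !opprK !addrA.
Qed.

(** Mirror image of [qlmx_qmin]: now [q + qconj q] and [q * qconj q] are real, and the product is a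
    right multiplication. *)
Lemma qrmx_qmin p q : qrmx (qmin q p) = starmx q p * starmx (qconj q) p.
Proof.
apply: eq_mulmx_quat => u; rewrite mulmxA !mulmx_starmx mulmx_qrmx.
rewrite /qmin qsqr_abs mulrDr mulrBr mulr_algr -scalerAr -[_ *: (u * p)]mulr_algl.
rewrite -qadd_conj -[_ *: u]mulr_algl -qconj_mul expr2.
rewrite mulrBr mulrBl mulrDl !mulrA !opprD !opprK.
rewrite addrC -!addrA; congr (_ + _).
by rewrite addrC -!addrA addrCA.
Qed.

Lemma starmx_comm q r p : GRing.comm q r -> GRing.comm (starmx q p) (starmx r p).
Proof.
move=> qr; apply: commrB; apply: commr_sym; apply: commrB.
- by rewrite /GRing.comm -!qlmxM qr.
- exact: qlmx_qrmx_comm.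
- exact/commr_sym/qlmx_qrmx_comm.
- exact: commr_refl.
Qed.

Lemma starmx_conj_comm q p : GRing.comm (starmx q p) (starmx (qconj q) p).
Proof. exact/starmx_comm/qconj_comm. Qed.

Lemma qconjK : involutive (@qconj R).
Proof. by move=> q; apply: quatP; split; rewrite !mxE /= ?opprK. Qed.

Lemma qmin_conj p q : qmin (qconj p) q = qmin p q.
Proof. by rewrite /qmin !qsqr_abs !qsqnormE /qre !mxE /= !sqrrN. Qed.

(** By [qlmx_qmin], [starmx q p] is one of two commuting factors of an invertible matrix. *)
Lemma starmx_unit q p : qmin p q != 0 -> starmx q p \is a GRing.unit.
Proof.
move=> /qlmx_unit; rewrite qlmx_qmin unitrM_comm => [/andP[]//|].
apply: commrB; apply: commr_sym; apply: commrB.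
- exact: commr_refl.
- exact: qlmx_qrmx_comm.
- exact/commr_sym/qlmx_qrmx_comm.
- apply: eq_mulmx_quat => u; rewrite !mulmxA !mulmx_qrmx -!mulrA.
  by rewrite (qconj_comm p).
Qed.

(** With [X' = starmx q (qconj p)], the two factors of [starV] are the operators [(X X')^-n] and
    [X'^n]. They commute and [X'^n] cancels, which leaves [X^-n]. *)
Lemma starVE q p n : qmin p q != 0 ->
  starV q p n = (1 : quat R) *m (starmx q p ^- n).
Proof.
move=> m0; have u1 := starmx_unit _ _ m0.
have u2 : starmx q (qconj p) \is a GRing.unit by rewrite starmx_unit // qmin_conj.
have c : GRing.comm (starmx q (qconj p)) (starmx q p).
  have := qlmx_qmin p q; rewrite -qmin_conj qlmx_qmin qconjK.
  by rewrite /GRing.comm => ->.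
rewrite /starV -/(qmin p q) starXE -mulmx_qlmx -mulmxA.
rewrite -exprVn qlmxX qlmxV // qlmx_qmin -c exprVn exprMn_comm //.
rewrite invrM ?unitrX // -[_ *m (_ / _)]/(_ * (_ / _)) mulrA.
have cn : GRing.comm (starmx q (qconj p) ^+ n) (starmx q p ^- n).
  exact/commrV/commrX/commr_sym/commrX/commr_sym.
by rewrite cn -mulrA mulrV ?unitrX // mulr1.
Qed.

Lemma mulr_QcVE q p n u : qmin q p != 0 ->
  u * QcV p n q = u *m (starmx q p * starmx (qconj q) p) ^- n.
Proof.
move=> m0; rewrite /QcV -/(qmin q p) -mulmx_qrmx -exprVn qrmxX qrmxV //.
by rewrite qrmx_qmin exprVn.
Qed.

Lemma starmx_sub_conj q p : starmx q p - starmx (qconj q) p = qlmx (q - qconj q).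
Proof. by rewrite /starmx opprB addrA subrK qlmxB. Qed.

Lemma starX_subconj q p n : starX q p n - starX (qconj q) p n =
  (q - qconj q) * \sum_(1 <= k < n.+1) starXconj q p (n - k) (k - 1).
Proof.
rewrite !starXE -mulmxBr subrXX_commr; last exact: starmx_conj_comm.
rewrite starmx_sub_conj mulmxA mulmx_qlmx; congr (_ * _).
rewrite mulmx_sumr big_add1 big_mkord; apply: eq_bigr => i _.
by rewrite starXconjE subn1 subnS -subn1 subnAC subn1.
Qed.

Lemma starV_subconj q p n : qmin p q != 0 -> qmin p (qconj q) != 0 ->
  starV q p n - starV (qconj q) p n =
  - ((q - qconj q) * (Hcal n q p * QcV p n q)).
Proof.
move=> m1 m2; have u1 := starmx_unit _ _ m1; have u2 := starmx_unit _ _ m2.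
(* [X] and [Y] are both invertible, hence so is [X Y], the right multiplication by [qmin q p]. *)
have m3 : qmin q p != 0.
  apply/eqP => m3; have := unitrM_comm (starmx_conj_comm q p).
  rewrite u1 u2 -qrmx_qmin m3 => /unitrP[A [_]].
  have -> : qrmx 0 = 0 by apply: eq_mulmx_quat => u; rewrite mulmx_qrmx mulr0 mulmx0.
  by move/eqP; rewrite mul0r eq_sym oner_eq0.
have cXY := starmx_conj_comm q p.
rewrite !starVE // mulr_QcVE // -mulmxBr.
set X := starmx q p in u1 cXY *; set Y := starmx _ _ in u2 cXY *.
have -> : X ^- n - Y ^- n = (X * Y) ^- n * (Y ^+ n - X ^+ n).
  rewrite mulrBr {1}cXY !exprMn_comm ?invrM ?unitrX //; try exact: commr_sym.
  by rewrite -!mulrA !mulVr ?unitrX // !mulr1.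
rewrite subrXX_commr; last exact: commr_sym.
(* The sum must act first, giving [Hcal]; then [(X Y)^-n], giving [QcV] on its right; then [Y - X],
   giving [- (q - qconj q)] on the far left. *)
have cZ : GRing.comm ((X * Y) ^- n) (\sum_(i < n) Y ^+ (n.-1 - i) * X ^+ i).
  apply: commr_sum => i _; apply: commr_sym; apply: commrV; apply: commrX.
  by apply: commrM; apply: commr_sym; apply: commrM; apply: commrX.
rewrite mulrA cZ -[Y - X]opprB mulrN starmx_sub_conj mulmxN 2!mulmxA mulmx_qlmx.
suff -> : (1 : quat R) *m (\sum_(i < n) Y ^+ (n.-1 - i) * X ^+ i) = Hcal n q p by [].
rewrite mulmx_sumr /Hcal big_add1 big_mkord.
apply: eq_bigr => i _; rewrite starXconjE subn1 subnS -subn1 subnAC subn1.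
congr (_ *m _); exact/commrX/commr_sym/commrX.
Qed.

End QuaternionOperators.

(** * Modulus and continuity of the quaternion operations *)

Lemma cvg_sumr {K : numFieldType} {V : pseudoMetricNormedZmodType K} T
    (F : set_system T) {FF : Filter F} I (r : seq I) (f : I -> T -> V) (l : I -> V) :
  (forall i, f i @ F --> l i) ->
  (fun t => \sum_(i <- r) f i t) @ F --> \sum_(i <- r) l i.
Proof.
move=> fl; elim: r => [|i r IH].
  by rewrite big_nil; under eq_fun do rewrite big_nil; exact: cvg_cst.
rewrite big_cons; under eq_fun do rewrite big_cons.
exact: cvgD.
Qed.

Section QuaternionModulus.
Context {R : realType}.
Implicit Types (p q u c : quat R) (m n k : nat).

Lemma qabs_ge0 q : 0 <= qabs q. Proof. exact: sqrtr_ge0. Qed.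

Lemma qabsM p q : qabs (p * q) = qabs p * qabs q.
Proof.
rewrite /qabs -sqrtrM; last by apply: sumr_ge0 => i _; exact: sqr_ge0.
by congr Num.sqrt; rewrite !qsqnormE !mxE /=; ring.
Qed.

Lemma qabs1 : qabs (1 : quat R) = 1.
Proof. by rewrite /qabs qsqnormE !mxE /= expr0n /= expr1n !addr0 sqrtr1. Qed.

Lemma qabs0 : qabs (0 : quat R) = 0.
Proof. by rewrite /qabs qsqnormE !mxE /= expr0n /= !addr0 sqrtr0. Qed.

Lemma qabs_eq0 q : (qabs q == 0) = (q == 0).
Proof. by rewrite -sqrf_eq0 qsqr_abs qsqnorm_eq0. Qed.

Lemma qabsX q n : qabs (q ^+ n) = qabs q ^+ n.
Proof. by elim: n => [|n IH]; rewrite ?expr0 ?qabs1 // !exprS qabsM IH. Qed.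

Lemma qabsV q : qabs q^-1 = (qabs q)^-1.
Proof.
have [->|q0] := eqVneq q 0; first by rewrite invr0 qabs0 invr0.
apply: (@mulIf _ (qabs q)); first by rewrite qabs_eq0.
by rewrite -qabsM mulVr // qabs1 mulVf // qabs_eq0.
Qed.

Lemma qabsZ (a : R) q : qabs (a *: q) = `|a| * qabs q.
Proof.
rewrite /qabs -sqrtr_sqr -sqrtrM ?sqr_ge0 //.
by congr Num.sqrt; rewrite !qsqnormE !mxE /=; ring.
Qed.

(** Transfers estimates made with the multiplicative modulus [qabs] to the maximum norm that defines
    the topology. *)
Lemma qnorm_le_abs q : `|q| <= qabs q.
Proof.
rewrite [`|q|]mx_normrE; apply/bigmax_leP; split; first exact: qabs_ge0.
move=> [i j] _ /=; rewrite -sqrtr_sqr ler_wsqrtr // ord1 /qsqnorm (bigD1 j) //=.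
by rewrite lerDl sumr_ge0 // => k _; exact: sqr_ge0.
Qed.

Lemma qcoord_continuous (i : 'I_4) : continuous (fun q : quat R => q 0 i).
Proof. by move=> q; exact: coord_continuous. Qed.

Lemma cvg_qcoord T (F : set_system T) {FF : Filter F} (f : T -> quat R) q
    (i : 'I_4) : f @ F --> q -> (f t 0 i : R) @[t --> F] --> (q 0 i : R).
Proof.
exact: (@continuous_cvg _ _ _ _ _ f (fun r : quat R => r 0 i) q
  (@qcoord_continuous i q)).
Qed.

Lemma cvg_quat T (F : set_system T) {FF : Filter F} (f : T -> quat R) q :
  (forall i : 'I_4, (f t 0 i : R) @[t --> F] --> (q 0 i : R)) -> f @ F --> q.
Proof.
move=> fq; rewrite [q]row_sum_delta.
have -> : f = fun t => \sum_(j < 4) f t 0 j *: qbasis j.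
  by apply/funext => t; exact: row_sum_delta.
by apply: cvg_sumr => i; apply: cvgZr_tmp => //; exact: fq.
Qed.

Lemma cvg_qmul T (F : set_system T) {FF : Filter F} (f g : T -> quat R) p q :
  f @ F --> p -> g @ F --> q -> (fun t => f t * g t) @ F --> p * q.
Proof.
move=> fp gq.
have fc i : (f t 0 i : R) @[t --> F] --> (p 0 i : R) by exact: cvg_qcoord.
have gc i : (g t 0 i : R) @[t --> F] --> (q 0 i : R) by exact: cvg_qcoord.
have m i j : (f t 0 i * g t 0 j : R) @[t --> F] --> (p 0 i * q 0 j : R).
  exact: cvgM (fc i) (gc j).
apply: cvg_quat => -[[|[|[|[|//]]]] hi]; rewrite !mxE /=.
all: under eq_fun do rewrite !mxE /=.
- exact: (cvgB (cvgB (cvgB (m 0 0) (m 1 1)) (m 2 2)) (m 3 3)).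
- exact: (cvgB (cvgD (cvgD (m 0 1) (m 1 0)) (m 2 3)) (m 3 2)).
- exact: (cvgD (cvgD (cvgB (m 0 2) (m 1 3)) (m 2 0)) (m 3 1)).
- exact: (cvgD (cvgB (cvgD (m 0 3) (m 1 2)) (m 2 1)) (m 3 0)).
Qed.

Lemma qabs_continuous : continuous (@qabs R).
Proof.
move=> q; apply: (@continuous_comp _ _ _ (@qsqnorm R) Num.sqrt).
  2: exact: sqrt_continuous.
apply: (@cvg_sumr _ _ _ _ (nbhs_filter q)) => i.
apply: cvgM; exact: qcoord_continuous.
Qed.

End QuaternionModulus.

(** * Termwise differentiation of quaternionic power series *)

Section DominatedSeries.
Context {R : realType} {V : completeNormedModType R}.

Lemma series_tail_le (u : nat -> V) (B : nat -> R) (N : nat) :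
  cvgn (series B) -> (forall n, `|u n| <= B n) ->
  `|limn (series u) - series u N| <= limn (series B) - series B N.
Proof.
move=> cB uB.
have B0 n : 0 <= B n by exact: le_trans (uB n).
have cu : cvgn (series u).
  exact: normed_cvg (series_le_cvg (fun n => normr_ge0 (u n)) B0 uB cB).
have h : `|series u n - series u N| @[n --> \oo] --> `|limn (series u) - series u N|.
  by apply: cvg_norm; apply: cvgB => //; exact: cvg_cst.
apply: (cvgr_to_le h); near=> m.
have Nm : (N <= m)%N by near: m; exact: nbhs_infty_ge.
rewrite sub_series Nm.
apply: (le_trans (ler_norm_sum _ _ _)).
apply: (@le_trans _ _ (series B m - series B N)).
  by rewrite sub_series Nm; apply: ler_sum => n _.
rewrite lerB // nondecreasing_cvgn_le //.
by apply/nondecreasing_seqP => n; rewrite seriesEnat /= big_nat_recr //= lerDl.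
Unshelve. all: by end_near. Qed.

(** Tannery's theorem: the tails are bounded, uniformly in [t], by those of [B], and the remaining
    partial sum converges term by term. *)
Lemma cvg_series_dominated T (F : set_system T) {FF : ProperFilter F}
    (g : nat -> T -> V) (l : nat -> V) (B : nat -> R) :
  cvgn (series B) -> (\forall t \near F, forall n, `|g n t| <= B n) ->
  (forall n, g n @ F --> l n) ->
  cvgn (series l) /\
  (fun t => limn (series (g^~ t))) @ F --> limn (series l).
Proof.
move=> cB gB gl.
have lB n : `|l n| <= B n.
  by apply: (cvgr_to_le (cvg_norm (gl n))); apply: filterS gB => t; apply.
split.
  have B0 n : 0 <= B n by exact: le_trans (lB n).
  exact: normed_cvg (series_le_cvg (fun n => normr_ge0 (l n)) B0 lB cB).
apply/cvgrPdist_lt => e e0.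
have e3 : 0 < e / 3 by rewrite divr_gt0.
have [N] : exists N, limn (series B) - series B N < e / 3.
  have /cvgrPdist_lt/(_ _ e3) [N _ /(_ N (leqnn N)) h] := cB.
  by exists N; exact: le_lt_trans (ler_norm _) h.
move=> NB.
have gN : (fun t => series (g^~ t) N) @ F --> series l N by exact: cvg_sumr.
near=> t.
have -> : limn (series l) - limn (series (g^~ t)) =
    (limn (series l) - series l N) + (series l N - series (g^~ t) N) +
    (series (g^~ t) N - limn (series (g^~ t))).
  by rewrite !addrA subrK subrK.
have h1 : `|limn (series l) - series l N| < e / 3.
  exact: le_lt_trans (series_tail_le _ _ _ cB lB) NB.
have h2 : `|series l N - series (g^~ t) N| < e / 3.
  by near: t; exact: (@cvgrPdist_lt _ _ _ _ _ _ _).1 gN _ e3.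
have h3 : `|series (g^~ t) N - limn (series (g^~ t))| < e / 3.
  rewrite distrC; apply: le_lt_trans NB; apply: series_tail_le => //.
  by near: t.
have -> : e = e / 3 + e / 3 + e / 3 by field.
apply: le_lt_trans (ler_normD _ _) _; apply: ltrD => //.
by apply: le_lt_trans (ler_normD _ _) _; apply: ltrD.
Unshelve. all: by end_near. Qed.

End DominatedSeries.

Section QuaternionPowerSeries.
Context {R : realType}.
Implicit Types (z w : quat R) (c : nat -> quat R).

(** Bounding [w] by [N] and [z] by [M] makes the sum telescope to [(N^n - M^n) / (N - M)]; the same
    bound [M] on both would leave a factor [n]. *)
Lemma qgeom_bound (M N : R) z w (c0 : quat R) n : qabs z <= M -> qabs w <= M -> M < N ->
  `|(\sum_(i < n) w ^+ (n.-1 - i) * z ^+ i) * c0| <=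
  (N - M)^-1 * (N ^+ n * qabs c0).
Proof.
move=> zM wM MN; have M0 : 0 <= M by exact: le_trans (qabs_ge0 z) zM.
rewrite mulr_suml; apply: (le_trans (ler_norm_sum _ _ _)).
apply: (@le_trans _ _ (\sum_(i < n) (N ^+ (n.-1 - i) * M ^+ i) * qabs c0)).
  apply: ler_sum => i _; apply: (le_trans (qnorm_le_abs _)).
  rewrite !qabsM !qabsX ler_wpM2r ?qabs_ge0 // ler_pM ?exprn_ge0 ?qabs_ge0 //.
    by rewrite lerXn2r ?nnegrE ?qabs_ge0 ?(le_trans M0 (ltW MN)) // (le_trans wM) // ltW.
  by rewrite lerXn2r ?nnegrE ?qabs_ge0.
rewrite -mulr_suml mulrA ler_wpM2r ?qabs_ge0 // ler_pdivlMl ?subr_gt0 // -subrXX.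
by rewrite gerBl exprn_ge0.
Qed.

(** The inner sum stands for the difference quotient of the [n]-th power between [Z t] and [z]. It
    tends to the formal derivative, and [qgeom_bound] provides the domination. *)
Lemma cvg_qpowser_quotient T (F : set_system T) {FF : ProperFilter F}
    (Z : T -> quat R) z c (N : R) :
  Z @ F --> z -> qabs z < N -> cvgn (series (fun n => N ^+ n * qabs (c n))) ->
  cvgn (series (fun n => (z ^+ n.-1 *+ n) * c n)) /\
  (fun t => limn (series (fun n => (\sum_(i < n) Z t ^+ (n.-1 - i) * z ^+ i) * c n)))
    @ F --> limn (series (fun n => (z ^+ n.-1 *+ n) * c n)).
Proof.
move=> Zz zN cN.
(* Any radius strictly between [qabs z] and [N] would do: eventually [qabs (Z t) < M], while [M < N]
   keeps [N - M] positive. *)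
pose M := (qabs z + N) / 2.
have [zM MN] : (qabs z < M) * (M < N) := midf_lt zN.
apply: (@cvg_series_dominated _ _ _ _ FF
   (fun n t => (\sum_(i < n) Z t ^+ (n.-1 - i) * z ^+ i) * c n)
   _ (fun n => (N - M)^-1 * (N ^+ n * qabs (c n)))).
- have -> : series (fun n => (N - M)^-1 * (N ^+ n * qabs (c n))) =
            (N - M)^-1 *: series (fun n => N ^+ n * qabs (c n)).
    by apply/funext => n; rewrite /series /= -mulr_sumr.
  exact: is_cvgZl_tmp.
- have Zq : qabs (Z t) @[t --> F] --> qabs z.
    exact: (@continuous_cvg _ _ _ _ _ Z (@qabs R) z (@qabs_continuous R z) Zz).
  have : \forall t \near F, qabs (Z t) < M by exact: cvgr_lt Zq _ zM.
  apply: filterS => t ZM n; apply: qgeom_bound => //; exact: ltW.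
- move=> n; apply: cvg_qmul; last exact: cvg_cst.
  have -> : z ^+ n.-1 *+ n = \sum_(i < n) (z ^+ (n.-1 - i) * z ^+ i).
    rewrite (eq_bigr (fun=> z ^+ n.-1)) ?sumr_const ?card_ord // => i _.
    by rewrite -exprD subnK //; case: n i => [[]|n i] //=; rewrite -ltnS.
  apply: cvg_sumr => i; apply: cvg_qmul; last exact: cvg_cst.
  elim: (n.-1 - i)%N => [|m IH]; first exact: cvg_cst.
  by under eq_fun do rewrite exprS; rewrite exprS; exact: cvg_qmul.
Qed.

(* In the applications [s h = h^-1] and [F = 0^']; the scalar [s] keeps the same
   statement usable for [Z h = x + h - p] and for its inverse. *)
Lemma cvg_qpowser_derive T (F : set_system T) {FF : ProperFilter F}
    (s : T -> R) (Z : T -> quat R) z (d : quat R) c (N : R) :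
  Z @ F --> z -> (s t *: (Z t - z)) @[t --> F] --> d ->
  (\forall t \near F, Z t != z /\ GRing.comm (Z t) z) ->
  (\forall t \near F, cvgn (series (fun n => Z t ^+ n * c n))) ->
  cvgn (series (fun n => z ^+ n * c n)) ->
  qabs z < N -> cvgn (series (fun n => N ^+ n * qabs (c n))) ->
  cvgn (series (fun n => (z ^+ n.-1 *+ n) * c n)) /\
  (s t *: (limn (series (fun n => Z t ^+ n * c n)) -
           limn (series (fun n => z ^+ n * c n)))) @[t --> F] -->
    d * limn (series (fun n => (z ^+ n.-1 *+ n) * c n)).
Proof.
move=> Zz sd nZ cZ cz zN cN.
have [cd Gd] := @cvg_qpowser_quotient _ _ _ _ _ _ _ Zz zN cN.
split=> //.
apply: cvg_trans (cvg_qmul _ _ _ _ _ _ sd Gd).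
apply: near_eq_cvg; near=> t.
have [Zn Zc] : Z t != z /\ GRing.comm (Z t) z by near: t.
have ct : cvgn (series (fun n => Z t ^+ n * c n)) by near: t.
have Zu : Z t - z != 0 by rewrite subr_eq0.
rewrite -scalerAl; congr (_ *: _).
set G := fun n => _ * c n.
have SG : series (fun n => Z t ^+ n * c n) - series (fun n => z ^+ n * c n) =
    (fun n => (Z t - z) * series G n).
  apply/funext => m; rewrite fctE /series /= mulr_sumr -sumrB.
  by apply: eq_bigr => n _; rewrite /G mulrA -subrXX_comm // mulrBl.
(* The quotient series converges because it is the difference of two convergent series divided by
   the nonzero [Z t - z]; only then does its limit satisfy the same factorisation. *)
have GE : series G = fun n => (Z t - z)^-1 *
    (series (fun n => Z t ^+ n * c n) - series (fun n => z ^+ n * c n)) n.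
  by apply/funext => n; rewrite SG mulKr.
rewrite -(cvg_lim _ (cvgB ct cz)) // SG.
apply/esym/cvg_lim => //; apply: cvg_qmul; first exact: cvg_cst.
suff : cvgn (series G) by [].
rewrite GE; apply: cvgP; apply: cvg_qmul; first exact: cvg_cst.
exact: cvgB ct cz.
Unshelve. all: by end_near. Qed.

End QuaternionPowerSeries.

(** * The Fueter operator on slice functions *)

Section DirectionalDerivatives.
Context {R : realType}.

Lemma near_eq_cvg_to T (U : topologicalType) (F : set_system T) {FF : Filter F}
    (f g : T -> U) (l : U) :
  f @ F --> l -> (\forall t \near F, f t = g t) -> g @ F --> l.
Proof.
move=> fl fg; apply: cvg_trans fl; apply: near_eq_cvg.
by apply: filterS fg => t ->.
Qed.

Lemma is_derive_cvg (V W : normedModType R) (f : V -> W) (x v : V) (d : W) :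
  is_derive x v f d <-> (h^-1 *: (f (h *: v + x) - f x)) @[h --> 0^'] --> d.
Proof.
split=> [[fx <-]|fd]; first exact: fx.
by split; [apply/cvg_ex; exists d|exact: cvg_lim fd].
Qed.

Lemma is_derive_line (V W : normedModType R) (f : V -> W) (x v : V) (d : W) :
  is_derive (0 : R) 1 (fun h => f (h *: v + x)) d -> is_derive x v f d.
Proof.
move=> /is_derive_cvg fd; apply/is_derive_cvg.
by move: fd; under eq_fun do rewrite scale0r add0r [_ *: 1]mulr1 addr0.
Qed.

Lemma is_derive_chain (W : normedModType R) (r : R -> R) (K : R -> W)
    (x r' : R) (k : W) :
  is_derive x 1 r r' -> is_derive (r x) 1 K k ->
  is_derive x 1 (K \o r) (r' *: k).
Proof.
move=> [dr rE] [dK KE].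
have /derivable1_diffP fr := dr; have /derivable1_diffP fK := dK.
split; first exact/derivable1_diffP/differentiable_comp.
rewrite deriveE; last exact: differentiable_comp.
rewrite diff_comp //= -['d r x 1]deriveE // rE -[X in 'd K _ X]mulr1.
by rewrite [LHS]linearZ -['d K _ 1]deriveE // KE.
Qed.

Lemma is_derive_qmul (V : normedModType R) (f g : V -> quat R) (x v : V) df dg :
  is_derive x v f df -> is_derive x v g dg ->
  is_derive x v (fun y => f y * g y) (df * g x + f x * dg).
Proof.
move=> /is_derive_cvg fd /is_derive_cvg gd; apply/is_derive_cvg.
(* Directional differentiability yields continuity along the line only, which suffices for the
   Leibniz splitting [(f(h) - f) g(h) + f (g(h) - g)]. *)
have gc : g (h *: v + x) @[h --> 0^'] --> g x.
  have h0 : (h : R) @[h --> 0^'] --> (0 : R) by move=> A; exact: nbhs_dnbhs.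
  have hg : h *: (h^-1 *: (g (h *: v + x) - g x)) + g x @[h --> 0^'] --> 0 *: dg + g x.
    by apply: cvgD; [exact: cvgZ|exact: cvg_cst].
  rewrite scale0r add0r in hg; apply: (near_eq_cvg_to _ _ _ _ _ _ hg); near=> h.
  rewrite scalerA divff ?scale1r ?subrK //.
  by near: h; exact: nbhs_dnbhs_neq.
have fgd : h^-1 *: (f (h *: v + x) - f x) * g (h *: v + x) +
    f x * (h^-1 *: (g (h *: v + x) - g x)) @[h --> 0^'] --> df * g x + f x * dg.
  by apply: cvgD; apply: cvg_qmul => //; exact: cvg_cst.
apply: (near_eq_cvg_to _ _ _ _ _ _ fgd); near=> h.
by rewrite -scalerAl -scalerAr -scalerDr mulrBl mulrBr addrA subrK.
Unshelve. all: by end_near. Qed.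

Lemma is_derive_qalg (x : R) : is_derive x 1 (fun t : R => t%:A : quat R) 1.
Proof.
apply/is_derive_cvg; apply: cvg_near_cst; near=> h.
rewrite -scalerBl [h *: 1]mulr1 addrK scalerA mulVf ?scale1r //.
by near: h; exact: nbhs_dnbhs_neq.
Unshelve. all: by end_near. Qed.

Lemma is_derive_partial_v (G : R * R -> quat R) u v :
  derivable G (u, v) ((0, 1) : R * R) ->
  is_derive v 1 (fun t : R => G (u, t)) (partial_v G (u, v)).
Proof.
move=> dG; have : is_derive (u, v) ((0, 1) : R * R) G (partial_v G (u, v)) by split.
move=> /is_derive_cvg Gd; apply/is_derive_cvg.
apply: (near_eq_cvg_to _ _ _ _ _ _ Gd); near=> h.
by congr (_ *: (G (_, _) - _)); rewrite /= [_ *: 0]mulr0 add0r.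
Unshelve. all: by end_near. Qed.

Lemma is_derive_partial_u (G : R * R -> quat R) u v :
  derivable G (u, v) ((1, 0) : R * R) ->
  is_derive u 1 (fun t : R => G (t, v)) (partial_u G (u, v)).
Proof.
move=> dG; have : is_derive (u, v) ((1, 0) : R * R) G (partial_u G (u, v)) by split.
move=> /is_derive_cvg Gd; apply/is_derive_cvg.
apply: (near_eq_cvg_to _ _ _ _ _ _ Gd); near=> h.
by congr (_ *: (G (_, _) - _)); rewrite /= [_ *: 0]mulr0 add0r.
Unshelve. all: by end_near. Qed.

End DirectionalDerivatives.

Section SliceFueter.
Context {R : realType}.
Implicit Types (q I J : quat R) (U : set (quat R)).

Lemma qre_imE q : q = (qre q)%:A + qim q.
Proof. by apply: quatP; split; rewrite /qre !mxE /=; ring. Qed.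

Lemma qim_sqr q : qim q * qim q = - (qabs (qim q) ^+ 2)%:A.
Proof. by rewrite qsqr_abs qsqnormE; apply: quatP; split; rewrite !mxE /=; ring. Qed.

Lemma imag_sphereN I : imag_sphere I -> imag_sphere (- I).
Proof.
move=> [I0 I1]; split; first by rewrite /qre mxE -[I 0 0]/(qre I) I0 oppr0.
by rewrite -scaleN1r qabsZ normrN1 mul1r.
Qed.

Lemma imag_sphere_qim q : qim q != 0 -> imag_sphere ((qabs (qim q))^-1 *: qim q).
Proof.
move=> q0; split; first by rewrite /qre !mxE /= mulr0.
by rewrite qabsZ ger0_norm ?invr_ge0 ?qabs_ge0 // mulVf // qabs_eq0.
Qed.

(** A negative [v] is absorbed by replacing [I] with [- I]. Both signs occur when the real axis is
    crossed. *)
Lemma slice_domain_mem U q v : axially_symmetric U -> U q ->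
  `|v| = qabs (qim q) -> slice_domain U (qre q, v).
Proof.
move=> Us Uq vq I SI; apply: (Us q Uq); rewrite /sphere_of /= -vq.
have [v0|v0] := leP 0 v; first by exists I; rewrite // ger0_norm.
exists (- I); first exact: imag_sphereN.
by rewrite ltr0_norm // scaleNr scalerN opprK.
Qed.

Lemma sum_ord4 (V : nmodType) (F : 'I_4 -> V) :
  \sum_(i < 4) F i = F 0 + F 1 + F 2 + F 3.
Proof.
rewrite !big_ord_recr big_ord0 /= add0r.
by do ![congr (_ + _)]; congr F; apply: val_inj.
Qed.

Lemma near_line (V : normedModType R) (P : V -> Prop) (x v : V) :
  (\forall y \near x, P y) -> \forall h \near (0 : R), P (h *: v + x).
Proof.
move=> Px; have : h *: v + x @[h --> (0 : R)] --> x.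
  rewrite -[X in _ --> X]add0r -[X in _ --> X + _](scale0r v).
  by apply: cvgD; [apply: cvgZr_tmp|exact: cvg_cst].
exact.
Qed.

Lemma qim_continuous : continuous (@qim R).
Proof.
move=> q; have -> : @qim R = fun y => y - (y 0 0)%:A.
  apply/funext => y; apply/esym/eqP; rewrite subr_eq addrC; apply/eqP.
  exact: qre_imE.
refine (@cvgB _ _ _ (nbhs q) _ _ _ _ _ _ _); first exact: cvg_id.
refine (@cvgZr_tmp _ _ _ (nbhs q) _ _ _ _ _); exact: qcoord_continuous.
Qed.

Lemma qbasis_im (i : 'I_4) : i != 0 -> qim (qbasis i : quat R) = qbasis i.
Proof.
move=> i0; rewrite [RHS]qre_imE /qre !mxE /= eq_sym (negbTE i0).
by rewrite scale0r add0r.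
Qed.

(** The squared modulus is a quadratic polynomial in [h], positive at [h = 0], where the square root
    is therefore differentiable. *)
Lemma is_derive_qabs_im q (i : 'I_4) : i != 0 -> qim q != 0 ->
  is_derive (0 : R) 1 (fun h => qabs (qim (h *: qbasis i + q)))
    (q 0 i / qabs (qim q)).
Proof.
move=> i0 q0.
have sE h : qsqnorm (qim (h *: qbasis i + q)) =
    qsqnorm (qim q) + (2 * q 0 i + h) * h.
  rewrite !qsqnormE !mxE /= => {q0}.
  case: i i0 => -[|[|[|[|//]]]] hi // _.
  - have -> : Ordinal hi = 1 by apply: val_inj.
    by rewrite /=; ring.
  - have -> : Ordinal hi = 2 by apply: val_inj.
    by rewrite /=; ring.
  - have -> : Ordinal hi = 3 by apply: val_inj.
    by rewrite /=; ring.
have s0 : 0 < qsqnorm (qim q).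
  by rewrite -qsqr_abs exprn_gt0 // lt_def qabs_ge0 qabs_eq0 q0.
have ds : is_derive (0 : R) 1 (fun h => qsqnorm (qim (h *: qbasis i + q))) (2 * q 0 i).
  apply/is_derive_cvg.
  have l : 2 * q 0 i + h @[h --> (0 : R)^'] --> 2 * q 0 i.
    rewrite -[X in _ --> X]addr0; apply: cvgD; first exact: cvg_cst.
    by move=> A; exact: nbhs_dnbhs.
  apply: (near_eq_cvg_to _ _ _ _ _ _ l); near=> h.
  rewrite !sE [h *: 1]mulr1 !addr0 mulr0 addr0 addrAC subrr add0r.
  rewrite [_ *: _]mulrC mulfK //.
  by near: h; exact: nbhs_dnbhs_neq.
have -> : q 0 i / qabs (qim q) = (2 * qabs (qim q))^-1 * (2 * q 0 i).
  by rewrite invfM mulrACA mulVf // mul1r mulrC.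
apply: (@is_derive1_comp _ Num.sqrt) => //.
rewrite scale0r add0r; exact: is_derive1_sqrt.
Unshelve. all: by end_near. Qed.

Lemma qabs_im_real (x : R) : qabs (qim (x%:A : quat R)) = 0.
Proof.
rewrite (_ : qim _ = 0) ?qabs0 //.
by apply: quatP; rewrite !mxE /= mulr0.
Qed.

Lemma qbasis_sqr (i : 'I_4) : i != 0 -> qbasis i * qbasis i = -1 :> quat R.
Proof.
move=> i0; rewrite -(qbasis_im _ i0) qim_sqr qsqr_abs (qbasis_im _ i0).
rewrite /qsqnorm (bigD1 i) //= big1 => [|j ji].
  by rewrite mxE !eqxx expr1n addr0 scale1r.
by rewrite mxE eqxx (negbTE ji) expr0n.
Qed.

Lemma is_derive_qalgV (x : R) : x != 0 ->
  is_derive x 1 (fun t : R => t^-1%:A : quat R) (- (x ^- 2)%:A).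
Proof.
move=> x0.
have dV : is_derive x 1 (fun t : R => t^-1) (- x ^- 2 *: 1).
  exact: (@is_deriveV _ id _ _ _ x0 (is_derive_id _ _)).
rewrite -scaleNr -[- x ^- 2]mulr1.
exact: (is_derive_chain _ _ _ _ _ _ dV (is_derive_qalg _)).
Qed.

Lemma sum_qbasis_im q :
  qbasis 1 * (q 0 1)%:A + qbasis 2 * (q 0 2)%:A + qbasis 3 * (q 0 3)%:A = qim q.
Proof. by apply: quatP; split; rewrite !mxE /=; ring. Qed.

(** Near [q], [f = alpha + qim * (beta / |qim|)]. The Cauchy-Riemann equations cancel every
    derivative of [alpha] and [beta] in [D f] and leave [-2 beta / |qim q|]. On the other side
    [f q - f (qconj q)] is [2 qim q * (beta / |qim q|)], and [q - qconj q = 2 qim q]. *)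
Lemma slice_fueter_nonreal U f q : open U -> axially_symmetric U ->
  left_slice_hyperholomorphic U f -> U q -> qim q != 0 ->
  fueter_derivable f q /\
  (q - qconj q) * fueter f q = -2 *: (f q - f (qconj q)).
Proof.
move=> Uo Us [al [be [Cal Cbe H]]] Uq q0.
pose N := qabs (qim q); pose u := qre q.
have N0 : N != 0 by rewrite qabs_eq0.
(* The imaginary unit is taken to be [qim y / |qim y|], which expresses [f] through functions of [y]
   that can be differentiated. *)
have fE y : U y -> qim y != 0 -> f y = al (qre y, qabs (qim y)) +
    qim y * ((qabs (qim y))^-1%:A * be (qre y, qabs (qim y))).
  move=> Uy y0; have Dy : slice_domain U (qre y, qabs (qim y)).
    by apply: slice_domain_mem => //; rewrite ger0_norm ?qabs_ge0.
  have [/(_ _ (imag_sphere_qim _ y0)) + _ _ _ _] := H _ _ Dy.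
  rewrite scalerA divff ?qabs_eq0 // scale1r -qre_imE => ->.
  by rewrite mulr_algl -scalerAr scalerAl.
have Dq : slice_domain U (u, N).
  by apply: slice_domain_mem => //; rewrite ger0_norm ?qabs_ge0.
have [_ _ _ cr1 cr2] := H _ _ Dq.
have [au av _ _] := Cal _ Dq; have [bu bv _ _] := Cbe _ Dq.
have nearU : \forall y \near q, U y /\ qim y != 0.
  near=> y; split; first by near: y; exact: open_nbhs_nbhs.
  suff : qabs (qim y) != 0 by rewrite qabs_eq0.
  near: y.
  have c : {for q, continuous (fun y : quat R => qabs (qim y))}.
    by apply: continuous_comp; [exact: qim_continuous|exact: qabs_continuous].
  by apply: (c [set t | t != 0]); exact: open_nbhs_nbhs.
have d0 : is_derive q (qbasis 0) f
    (partial_u al (u, N) + qim q * (N^-1%:A * partial_u be (u, N))).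
  apply: is_derive_line.
  have re0 h : qre (h *: qbasis 0 + q) = shift u h.
    by rewrite /u /qre !mxE /= mulr1.
  have im0 h : qim (h *: qbasis 0 + q) = qim q.
    by apply: quatP; split; rewrite !mxE /= ?mulr0 ?add0r.
  have D1 (G : R * R -> quat R) : derivable G (u, N) ((1, 0) : R * R) ->
      is_derive (0 : R) 1 (fun h => G (shift u h, N)) (partial_u G (u, N)).
    move=> /(is_derive_partial_u _ _ _) dG; rewrite -[partial_u _ _]scale1r.
    apply: (is_derive_chain _ (shift u) (fun t => G (t, N)) _ _ _ _); last by rewrite /= add0r.
    exact: is_derive_shift.
  have D2 : is_derive (0 : R) 1 (fun h => qim q * (N^-1%:A * be (shift u h, N)))
     (qim q * (N^-1%:A * partial_u be (u, N))).
    have e1 := is_derive_qmul _ _ _ _ _ _ _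
      (is_derive_cst (N^-1%:A : quat R) (0 : R) 1) (D1 _ bu).
    have := is_derive_qmul _ _ _ _ _ _ _
      (is_derive_cst (qim q) (0 : R) 1) e1.
    by rewrite !mul0r !add0r.
  apply: (near_eq_is_derive _ (is_deriveD (D1 _ au) D2)).
  near=> h => /=.
  have [Uh qh] : U (h *: qbasis 0 + q) /\ qim (h *: qbasis 0 + q) != 0.
    by near: h; exact: near_line _ _ _ _ nearU.
  by rewrite (fE _ Uh qh) re0 im0.
(* The derivative at [t = N] of the radial factor [t^-1 * beta (u, t)]. *)
pose b' := - (N ^- 2)%:A * be (u, N) + N^-1%:A * partial_v be (u, N).
have d1 (i : 'I_4) : i != 0 -> is_derive q (qbasis i) f
    ((q 0 i / N) *: partial_v al (u, N) +
     (qbasis i * (N^-1%:A * be (u, N)) + qim q * ((q 0 i / N) *: b'))).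
  move=> i0; apply: is_derive_line.
  have re0 h : qre (h *: qbasis i + q) = u.
    by rewrite /u /qre !mxE /= eq_sym (negbTE i0) mulr0 add0r.
  have imE h : qim (h *: qbasis i + q) = h *: qbasis i + qim q.
    rewrite -{2}(qbasis_im _ i0); apply: quatP.
    by split; rewrite !mxE /= ?mulr0 ?add0r.
  pose r h := qabs (qim (h *: qbasis i + q)).
  have dr := is_derive_qabs_im _ _ i0 q0; rewrite -/N -/r in dr.
  have r0 : r 0 = N by rewrite /r scale0r add0r.
  have dal k := is_derive_chain _ _ (fun t => al (u, t)) _ _ k dr.
  rewrite r0 in dal; have {}dal := dal _ (is_derive_partial_v al u N av).
  have dbe : is_derive (r 0) 1 (fun t => t^-1%:A * be (u, t)) b'.
    rewrite r0.
    exact: is_derive_qmul _ _ _ _ _ _ _ (is_derive_qalgV _ N0)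
      (is_derive_partial_v _ _ _ bv).
  have dv : is_derive (0 : R) 1 (fun h : R => qim (h *: qbasis i + q)) (qbasis i).
    apply/is_derive_cvg; apply: cvg_near_cst; near=> h.
    rewrite !imE addr0 scale0r add0r addrK [h *: 1]mulr1 scalerA mulVf ?scale1r //.
    by near: h; exact: nbhs_dnbhs_neq.
  have dw := is_derive_qmul _ _ _ _ _ _ _ dv (is_derive_chain _ _ _ _ _ _ dr dbe).
  have := is_deriveD dal dw; rewrite /= r0 scale0r add0r.
  apply: near_eq_is_derive; near=> h => /=.
  have [Uh qh] : U (h *: qbasis i + q) /\ qim (h *: qbasis i + q) != 0.
    by near: h; exact: near_line _ _ _ _ nearU.
  by rewrite (fE _ Uh qh) re0.
have Uc : U (qconj q).
  have -> : qconj q = u%:A + N *: (- (N^-1 *: qim q)).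
    rewrite scalerN scalerA divff // scale1r.
    by apply: quatP; split; rewrite /u /qre !mxE /=; ring.
  exact/Dq/imag_sphereN/imag_sphere_qim.
have imc : qim (qconj q) = - qim q.
  by apply: quatP; split; rewrite !mxE /= ?oppr0.
have absN y : qabs (- y : quat R) = qabs y.
  by rewrite -scaleN1r qabsZ normrN1 mul1r.
have fc : f (qconj q) = al (u, N) - qim q * (N^-1%:A * be (u, N)).
  by rewrite fE ?imc ?oppr_eq0 // /qre !mxE /= absN mulNr.
have qc : q - qconj q = qim q *+ 2.
  by apply: quatP; split; rewrite !mxE /=; ring.
split.
  move=> i; have [->|i0] := eqVneq i 0; first by case: d0.
  by have [] := d1 i i0.
pose Y : quat R := N^-1%:A * be (u, N).
have -> : fueter f q = -2 *: Y.
  (* The radial term [X] is common to the three imaginary directions. Weighted by [e_i q_i] it adds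
     up to [qim q * X], while each [e_i * e_i = -1] contributes one [- Y]. *)
  pose X : quat R := N^-1 *: partial_v al (u, N) + qim q * (N^-1 *: b').
  have Di (i : 'I_4) : i != 0 ->
      qbasis i * 'D_(qbasis i) f q = qbasis i * (q 0 i)%:A * X - Y.
    move=> i0; have [_ ->] := d1 i i0.
    rewrite mulrDr [X in _ + X]mulrDr mulrA (qbasis_sqr _ i0) mulN1r -/Y.
    rewrite addrA addrAC; congr (_ - Y).
    rewrite /X mulrDr; congr (_ + _).
      by rewrite mulr_algr -!scalerAl -!scalerAr scalerA.
    by rewrite mulr_algr -!scalerAl -!scalerAr scalerA.
  rewrite /fueter sum_ord4 (Di 1) // (Di 2) // (Di 3) //.
  have [_ ->] := d0.
  rewrite -[qbasis 0]/(1 : quat R) mul1r.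
  have sumE (a x y z e : quat R) :
      a + (x - e) + (y - e) + (z - e) = a + (x + y + z) - e *+ 3.
    rewrite -(addrA (a + _)) -(addrA a) [y - e + _]addrACA [x - e + _]addrACA.
    rewrite !addrA -!addrA; do 4 congr (_ + _).
    by rewrite !mulrS mulr0n addr0 !opprD.
  rewrite sumE -!mulrDl sum_qbasis_im cr1.
  (* Since [qim q * qim q = - N^2], the term in [b'] gives back one [Y], so that [- 3 Y] becomes
     [- 2 Y]; the partial derivatives cancel by Cauchy-Riemann. *)
  have VX : qim q * X = qim q * (N^-1 *: partial_v al (u, N)) + (Y - partial_v be (u, N)).
    rewrite /X mulrDr; congr (_ + _); rewrite mulrA qim_sqr mulNr mulr_algl scalerA.
    rewrite -/N expr2 mulfK // /b' scalerDr opprD mulNr scalerN opprK !mulr_algl !scalerA.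
    have -> : N * N ^- 2 = N^-1 by rewrite expr2 invfM mulrA divff // mul1r.
    by rewrite divff // scale1r /Y mulr_algl.
  rewrite VX cr2 mulr_algl scalerN mulrN.
  rewrite addrA addrK [_ + (Y - _)]addrC subrK.
  by rewrite scaleNr scaler_nat [Y *+ 3]mulrS opprD addNKr.
rewrite fE // -/u -/N -/Y fc qc -/Y.
have -> (x y : quat R) : x + y - (x - y) = y *+ 2.
  by rewrite opprB addrC addrA subrK mulr2n.
by rewrite -scalerAr mulrnAl.
Unshelve. all: by end_near. Qed.


Lemma imag_sphere_qbasis (i : 'I_4) : i != 0 -> imag_sphere (qbasis i : quat R).
Proof.
move=> i0; split; first by rewrite /qre mxE /= eq_sym (negbTE i0).
rewrite /qabs /qsqnorm (bigD1 i) //= big1 => [|j ji].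
  by rewrite mxE !eqxx expr1n addr0 sqrtr1.
by rewrite mxE eqxx (negbTE ji) expr0n.
Qed.

Lemma qre_real (x : R) : qre (x%:A : quat R) = x.
Proof. by rewrite /qre !mxE /= mulr1. Qed.

(** On the real axis [beta] vanishes by oddness, hence so do its [u]-derivative and, by
    Cauchy-Riemann, the [v]-derivative of [alpha]. Each imaginary direction then contributes
    [e_i e_i] times the [v]-derivative of [beta], that is, minus the [u]-derivative of [alpha]; the
    total coefficient is [1 - 3 = -2]. *)
Lemma slice_fueter_real U f (x : R) : open U -> axially_symmetric U ->
  left_slice_hyperholomorphic U f -> U x%:A ->
  fueter_derivable f x%:A /\
  fueter f x%:A = -2 *: 'D_(qbasis 0) f x%:A.
Proof.
move=> Uo Us [al [be [Cal Cbe H]]] Ux.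
have Ureal t : U t%:A -> slice_domain U (t, 0).
  move=> Ut; rewrite -[t](qre_real t); apply: slice_domain_mem => //.
  by rewrite normr0 qabs_im_real.
have be0 t : U t%:A -> be (t, 0) = 0.
  move=> /Ureal /H[_ _ + _ _]; rewrite oppr0 => b0.
  apply/eqP; have : 2 *: be (t, 0) = 0.
    by rewrite scaler_nat mulr2n {1}b0 addNr.
  by move/eqP; rewrite scaler_eq0 pnatr_eq0.
have Dx := Ureal x Ux.
have [_ _ _ cr1 cr2] := H _ _ Dx.
have [au av _ _] := Cal _ Dx; have [bu bv _ _] := Cbe _ Dx.
have nearU : \forall y \near (x%:A : quat R), U y by exact: open_nbhs_nbhs.
have line0 (t : R) : t *: qbasis 0 + x%:A = (shift x t)%:A :> quat R.
  by rewrite -[qbasis 0]/(1 : quat R) -scalerDl.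
have D1 (G : R * R -> quat R) : derivable G (x, 0) ((1, 0) : R * R) ->
    is_derive (0 : R) 1 (fun h => G (shift x h, 0)) (partial_u G (x, 0)).
  move=> /(is_derive_partial_u _ _ _) dG; rewrite -[partial_u _ _]scale1r.
  apply: (is_derive_chain _ (shift x) (fun t => G (t, 0)) _ _ _ _).
    exact: is_derive_shift.
  by rewrite /= add0r.
have d0 : is_derive (x%:A : quat R) (qbasis 0) f (partial_u al (x, 0)).
  apply: is_derive_line; apply: (near_eq_is_derive _ (D1 _ au)); near=> h => /=.
  have Uh : U (h *: qbasis 0 + x%:A) by near: h; exact: near_line _ _ _ _ nearU.
  rewrite line0 in Uh *.
  have [/(_ _ (imag_sphere_qbasis 1 isT)) + _ _ _ _] := H _ _ (Ureal _ Uh).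
  by rewrite be0 // mulr0 scale0r !addr0 => ->.
have bu0 : partial_u be (x, 0) = 0.
  have [_ <-] := D1 _ bu; rewrite -[RHS](derive_cst (0 : quat R) (0 : R) 1).
  apply: near_eq_derive; near=> h => /=; apply: be0; rewrite -line0.
  by near: h; exact: near_line _ _ _ _ nearU.
have av0 : partial_v al (x, 0) = 0 by rewrite cr2 bu0 oppr0.
have d1 (i : 'I_4) : i != 0 ->
    is_derive (x%:A : quat R) (qbasis i) f (qbasis i * partial_v be (x, 0)).
  move=> i0; apply: is_derive_line.
  have e1 := is_derive_qmul _ _ _ _ _ _ _ (is_derive_cst (qbasis i : quat R) (0 : R) 1)
    (is_derive_partial_v _ _ _ bv).
  have := is_deriveD (is_derive_partial_v _ _ _ av) e1.
  rewrite av0 mul0r !add0r; apply: near_eq_is_derive; near=> h => /=.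
  have Uh : U (h *: qbasis i + x%:A) by near: h; exact: near_line _ _ _ _ nearU.
  have reE : qre (h *: qbasis i + x%:A) = x.
    by rewrite /qre !mxE /= eq_sym (negbTE i0) mulr0 mulr1 add0r.
  have imE : qim (h *: qbasis i + x%:A) = h *: qbasis i.
    rewrite -[in RHS](qbasis_im _ i0); apply: quatP.
    by split; rewrite !mxE /= ?mulr0 ?addr0.
  have [_ iS] := imag_sphere_qbasis i i0.
  have Dh : slice_domain U (x, h).
    by rewrite -reE; apply: slice_domain_mem => //; rewrite imE qabsZ iS mulr1.
  have [/(_ _ (imag_sphere_qbasis i i0)) fE _ _ _ _] := H _ _ Dh.
  by rewrite [in RHS]addrC fE.
split.
  move=> i; have [->|i0] := eqVneq i 0; first by case: d0.
  by have [] := d1 i i0.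
have Di (i : 'I_4) : i != 0 ->
    qbasis i * 'D_(qbasis i) f x%:A = -1 * partial_v be (x, 0).
  by move=> i0; have [_ ->] := d1 i i0; rewrite mulrA (qbasis_sqr _ i0).
rewrite /fueter sum_ord4 (Di 1) // (Di 2) // (Di 3) //.
have [_ ->] := d0; rewrite -[qbasis 0]/(1 : quat R) cr1 -!mulrDl -[RHS]mulr_algl.
by congr (_ * _); rewrite subrr add0r scaleNr scaler_nat mulr2n opprD.
Unshelve. all: by end_near. Qed.

End SliceFueter.

(** * Laurent series on the shell *)

Section Shell.
Context {R : realType}.
Implicit Types p q I J : quat R.

Lemma imag_sphere_sqr I : imag_sphere I -> I * I = -1.
Proof.
move=> [I0 I1]; have {1 2}-> : I = qim I by rewrite {1}[I]qre_imE I0 scale0r add0r.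
by rewrite qim_sqr -[qim I]add0r -[in 0 + _](scale0r 1) -I0 -qre_imE I1 expr1n scale1r.
Qed.

Lemma imag_sphere_neq0 I : imag_sphere I -> I != 0.
Proof. by move=> [_ I1]; rewrite -qabs_eq0 I1 oner_eq0. Qed.

Lemma qre_plane (x y : R) I : imag_sphere I -> qre (x%:A + y *: I) = x.
Proof. by move=> [I0 _]; move: I0; rewrite /qre !mxE /= => ->; rewrite mulr0 addr0 mulr1. Qed.

Lemma plane_eq0 (x y : R) I : imag_sphere I -> x%:A + y *: I = 0 -> x = 0 /\ y = 0.
Proof.
move=> SI h; have x0 : x = 0 by rewrite -(qre_plane x y _ SI) h /qre mxE.
split=> //; move: h; rewrite x0 scale0r add0r => /eqP.
by rewrite scaler_eq0 (negbTE (imag_sphere_neq0 _ SI)) orbF => /eqP.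
Qed.

Lemma plane_mul (a b c d : R) I : imag_sphere I ->
  (a%:A + b *: I) * (c%:A + d *: I) = (a * c - b * d)%:A + (a * d + b * c) *: I.
Proof.
move=> SI; have -> : (a%:A + b *: I) * (c%:A + d *: I) =
    (a * c)%:A + (a * d) *: I + ((b * c) *: I + (b * d) *: (I * I)).
  rewrite mulrDl !mulrDr -!scalerAl -!scalerAr !mul1r mulr1 !scalerA.
  by [].
rewrite imag_sphere_sqr // [(b * c) *: I + _]addrC addrACA.
by rewrite scalerBl scalerDl scalerN.
Qed.

Lemma plane_comm (a b c d : R) I : imag_sphere I ->
  GRing.comm (a%:A + b *: I) (c%:A + d *: I).
Proof.
move=> SI; rewrite /GRing.comm !plane_mul //.
by rewrite [c * a]mulrC [d * b]mulrC [c * b]mulrC [d * a]mulrC [b * c + _]addrC.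
Qed.

Lemma qabs_plane (x y : R) I : imag_sphere I ->
  qabs (x%:A + y *: I) ^+ 2 = x ^+ 2 + y ^+ 2.
Proof.
move=> SI; rewrite qsqr_abs.
have [I0 I1] := SI; have : qsqnorm I = 1 by rewrite -qsqr_abs I1 expr1n.
move: I0; rewrite /qre !qsqnormE !mxE /= => -> h.
transitivity (x ^+ 2 + y ^+ 2 * (0 ^+ 2 + I 0 1 ^+ 2 + I 0 2 ^+ 2 + I 0 3 ^+ 2)).
  by ring.
by rewrite h mulr1.
Qed.

(** The zeros of [qmin p] form the sphere of [p], so at a zero [p] would be [x + y I] or [x - y I].
    Both points of the slice are at distance more than [R1 > 0] from [p]. *)
Lemma shell_qmin p (R1 R2 : \bar R) q : (0 < R1)%E -> Omega_shell p R1 R2 q -> qmin p q != 0.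
Proof.
move=> R10 [I [SI [p0 [p1 pE]] [J [x [y [SJ [_ [h1 _]] [_ [h2 _]] ->]]]]]].
apply/eqP => m0.
have ne (z : quat R) : (R1 < (qabs (z - p))%:E)%E -> z != p.
  apply: contraPneq => ->; rewrite subrr qabs0; apply/negP.
  by rewrite -leNgt; exact: ltW.
have {}h1 := ne _ h1; have {}h2 := ne _ h2.
move: m0; rewrite /qmin pE qabs_plane // qre_plane // expr2 plane_mul //.
rewrite scalerDr !scalerA opprD addrACA -!scalerBl addrAC -scalerDl => m0.
have [re0 im0] := plane_eq0 _ _ J SJ m0.
have /eqP : (x - p0) * y = 0 by apply: (@mulfI _ 2); rewrite ?pnatr_eq0 // mulr0 -im0; ring.
rewrite mulf_eq0 subr_eq0 => /orP[/eqP xE|/eqP y0].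
  have /eqP : y ^+ 2 = p1 ^+ 2.
    by apply/eqP; rewrite eq_sym -subr_eq0 -re0 xE; apply/eqP; ring.
  rewrite eqf_sqr => /orP[/eqP yE|/eqP yE].
    by move: h1; rewrite pE xE yE eqxx.
  by move: h2; rewrite pE xE yE scaleNr opprK eqxx.
have : (x - p0) ^+ 2 + p1 ^+ 2 == 0 by rewrite -re0 y0; apply/eqP; ring.
rewrite paddr_eq0 ?sqr_ge0 // !sqrf_eq0 subr_eq0 => /andP[/eqP xE /eqP p10].
by move: h1; rewrite pE xE y0 p10 eqxx.
Qed.

Lemma shell_conj p (R1 R2 : \bar R) q : Omega_shell p R1 R2 q -> Omega_shell p R1 R2 (qconj q).
Proof.
move=> [I [SI pI [J [x [y [SJ h1 h2 ->]]]]]]; exists I; split => //.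
exists (- J), x, y; split => //; first exact: imag_sphereN.
have [J0 _] := SJ; move: J0; rewrite /qre => J0.
apply: quatP; split; rewrite !mxE /=; try ring.
by rewrite J0; ring.
Qed.

Lemma shell_plane p (R1 R2 : \bar R) I (x y : R) : imag_sphere I -> complex_plane I p ->
  (R1 < (qabs (x%:A + y *: I - p))%:E < R2)%E ->
  (R1 < (qabs (x%:A - y *: I - p))%:E < R2)%E ->
  Omega_shell p R1 R2 (x%:A + y *: I).
Proof.
move=> SI pI /andP[h1 h2] /andP[h3 h4]; exists I; split => //; exists I, x, y.
by split=> //; split=> //; [exists x, y|exists x, (- y); rewrite scaleNr].
Qed.

Lemma shell_real p (R1 R2 : \bar R) (x : R) : Omega_shell p R1 R2 x%:A ->
  exists I (p0 p1 : R), [/\ imag_sphere I, p = p0%:A + p1 *: I &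
    (R1 < (qabs (x%:A - p))%:E < R2)%E].
Proof.
move=> [I [SI [p0 [p1 pE]] [J [x' [y [SJ [_ [h1 h2]] _ xE]]]]]].
exists I, p0, p1; split=> //.
have [x0 y0] : x - x' = 0 /\ - y = 0.
  apply: (plane_eq0 _ _ J SJ).
  by rewrite scalerBl xE scaleNr addrAC addrK subrr.
move: x0 y0 => /subr0_eq -> /eqP; rewrite oppr_eq0 => /eqP y0.
by move: h1 h2; rewrite y0 scale0r addr0 => -> ->.
Qed.

Lemma ereal_between_near (r : R) (R1 R2 : \bar R) : (R1 < r%:E < R2)%E ->
  \forall s \near r, (R1 < s%:E < R2)%E.
Proof.
move=> /andP[h1 h2]; near=> s; apply/andP; split; near: s.
  case: R1 h1 => [a| |] //; last by move=> _; near=> s; rewrite ltNyr.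
  by rewrite lte_fin => ar; near=> s; rewrite lte_fin; near: s; exact: lt_nbhsr.
case: R2 h2 => [a| |] //; last by move=> _; near=> s; rewrite ltry.
by rewrite lte_fin => ar; near=> s; rewrite lte_fin; near: s; exact: lt_nbhsl.
Unshelve. all: by end_near. Qed.

Lemma annulus_near p q (R1 R2 : \bar R) : (R1 < (qabs (q - p))%:E < R2)%E ->
  \forall z \near q, (R1 < (qabs (z - p))%:E < R2)%E.
Proof.
move=> /ereal_between_near h.
have c : {for q, continuous (fun z : quat R => qabs (z - p))}.
  apply: continuous_comp; last exact: qabs_continuous.
  refine (@cvgB _ _ _ (nbhs q) _ _ _ _ _ _ _); [exact: cvg_id|exact: cvg_cst].
exact: c h.
Qed.

Lemma cvg_abs_unif_at m (u : nat -> quat R -> quat R) (A : set (quat R)) q :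
  cvg_abs_unif_on_compacts m u A -> A q ->
  cvgn (fun N => \sum_(m <= n < N) qabs (u n q)) /\
  cvgn (partial_sum m (u ^~ q)).
Proof.
move=> uA Aq; have [|/(_ q erefl) h1 h2] := uA [set q] (@compact_set1 _ q).
  by move=> _ ->.
split=> //; move: h2; rewrite uniform_set1 => h2.
exact: cvgP h2.
Qed.

End Shell.

(** * Star powers and kernels at points commuting with [p] *)

Section CommutingPoints.
Context {R : realType}.
Implicit Types (p q w : quat R) (m n k : nat).

(** Every iterate [w * (q - p)^n] still commutes with [q], so on it [L_q - R_p] acts as right
    multiplication by [q - p]. *)
Lemma mulmx_starmxX_comm w q p n : GRing.comm q p -> GRing.comm q w ->
  w *m (starmx q p ^+ n) = w * (q - p) ^+ n.
Proof.
move=> qp qw; elim: n => [|n IH]; first by rewrite mulmx1 mulr1.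
rewrite exprSr mulmxA IH mulmx_starmx exprSr [RHS]mulrA [RHS]mulrBr.
have -> : q * (w * (q - p) ^+ n) = w * (q - p) ^+ n * q; last by [].
by apply: commrM => //; apply: commrX; apply: commrB; [exact: commr_refl|].
Qed.

Lemma starX_comm q p n : GRing.comm q p -> starX q p n = (q - p) ^+ n.
Proof.
by move=> qp; rewrite starXE mulmx_starmxX_comm ?mul1r //; exact: commr1.
Qed.

(** The operator [X^n] sends [(q - p)^-n] to [1], so this element is [X^-n 1]. *)
Lemma starV_comm q p n : GRing.comm q p -> qmin p q != 0 ->
  starV q p n = (q - p)^-1 ^+ n.
Proof.
move=> qp m0; have Xu := starmx_unit _ _ m0.
have z0 : q - p != 0.
  apply: contraNneq m0 => z0.
  have := qlmx_qmin p q; move/(congr1 (fun A => (1 : quat R) *m A)).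
  by rewrite mulmx_qlmx mulr1 mulmxA !mulmx_starmx mulr1 mul1r z0 mulr0 mul0r subrr => ->.
have cw : GRing.comm q ((q - p)^-1 ^+ n).
  by apply: commrX; apply: commrV; apply: commrB; [exact: commr_refl|].
have wX : (q - p)^-1 ^+ n *m (starmx q p ^+ n) = (1 : quat R).
  rewrite mulmx_starmxX_comm // -exprMn_comm ?mulVr ?expr1n //.
  exact/commr_sym/commrV/commr_refl.
by rewrite starVE // -wX -mulmxA -[_ *m _ ^- n]/(_ * _) mulrV ?unitrX // mulmx1.
Qed.

Lemma comm_real (t : R) q : GRing.comm t%:A q.
Proof. by rewrite /GRing.comm mulr_algl mulr_algr. Qed.

Lemma qconj_real (t : R) : qconj (t%:A : quat R) = t%:A.
Proof. by apply: quatP; split; rewrite !mxE /= ?mulr0 ?oppr0. Qed.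

Lemma starXconj_real (t : R) p m k :
  starXconj t%:A p m k = (t%:A - p) ^+ (m + k).
Proof.
rewrite starXconjE qconj_real -exprD mulmx_starmxX_comm ?mul1r //.
  exact: comm_real.
exact: commr1.
Qed.

Lemma sum_starXconj_real (t : R) p n :
  \sum_(1 <= k < n.+2) starXconj t%:A p (n.+1 - k) (k - 1) = (t%:A - p) ^+ n *+ n.+1.
Proof.
rewrite big_add1 big_mkord (eq_bigr (fun=> (t%:A - p) ^+ n)) ?sumr_const ?card_ord //.
by move=> i _; rewrite starXconj_real subSS subn1 subnK // -ltnS.
Qed.

(** At a real point the [n] terms of [Hcal] all equal [(t - p)^(n-1)], and [qmin t p = (t - p)^2].
    The result is left as [w^2] times the derivative of [w^n] at [w = (t - p)^-1], the shape
    produced by the chain rule for the principal part. *)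
Lemma Hcal_QcV_real (t : R) p n : t%:A != p ->
  Hcal n t%:A p * QcV p n t%:A = (t%:A - p)^-1 ^+ 2 * ((t%:A - p)^-1 ^+ n.-1 *+ n).
Proof.
move=> tp; have z0 : t%:A - p != 0 by rewrite subr_eq0.
case: n => [|n]; first by rewrite /Hcal big_geq // mul0r mulr0n mulr0.
have -> : Hcal n.+1 t%:A p = (t%:A - p) ^+ n *+ n.+1.
  rewrite /Hcal big_add1 big_mkord (eq_bigr (fun=> (t%:A - p) ^+ n)) ?sumr_const ?card_ord //.
  by move=> i _; rewrite starXconj_real !subSS subn0 subnKC // -ltnS.
have qE : qmin t%:A p = (t%:A - p) ^+ 2.
  have := qrmx_qmin p t%:A; move/(congr1 (fun A => (1 : quat R) *m A)).
  rewrite mulmx_qrmx mul1r qconj_real -expr2 mulmx_starmxX_comm ?mul1r //.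
    exact: comm_real.
  exact: commr1.
rewrite /QcV -/(qmin _ _) qE -exprM -exprVn mulrnAl mulrnAr; congr (_ *+ _).
rewrite (_ : (2 * n.+1 = n + (2 + n))%N); last by rewrite mulnS mul2n -addnn addnCA.
have zw : (t%:A - p) ^+ n * (t%:A - p)^-1 ^+ n = 1.
  by rewrite exprVn divrr // unitrX.
by rewrite exprD [LHS]mulrA zw mul1r exprD.
Qed.

Lemma mulr_Htilde n q p (c : quat R) :
  Htilde n q p * ((- (2 * n.+1%:R)) *: c) =
  -2 *: ((\sum_(1 <= k < n.+2) starXconj q p (n.+1 - k) (k - 1)) * c).
Proof.
rewrite /Htilde -scalerAl -scalerAr scalerA; congr (_ *: _).
by rewrite mulrN mulrCA mulVf ?mulr1 // pnatr_eq0.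
Qed.

Lemma cvg_qinv T (F : set_system T) {FF : Filter F} (f : T -> quat R) q :
  f @ F --> q -> q != 0 -> (fun t => (f t)^-1) @ F --> q^-1.
Proof.
move=> fq q0.
have cf i : (f t 0 i : R) @[t --> F] --> (q 0 i : R) by exact: cvg_qcoord.
have cabs : qabs (f t) @[t --> F] --> qabs q.
  exact: (@continuous_cvg _ _ _ _ _ f (@qabs R) q (@qabs_continuous R q) fq).
have cconj : qconj (f t) @[t --> F] --> qconj q.
  have E (r : quat R) : qconj r = (2 * r 0 0)%:A - r.
    by rewrite -/(qre r) -qadd_conj addrC addKr.
  rewrite E; under eq_fun do rewrite E.
  apply: cvgB => //; apply: cvgZr_tmp; apply: cvgM => //; exact: cvg_cst.
have invE (r : quat R) : r^-1 = (qabs r ^+ 2)^-1 *: qconj r by rewrite qsqr_abs.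
rewrite invE; under eq_fun do rewrite invE.
apply: cvgZ => //; apply: cvgV; first by rewrite sqrf_eq0 qabs_eq0.
exact: cvgM.
Qed.

End CommutingPoints.

(** * Differentiating the Laurent series at a real point *)

Section LaurentFueter.
Context {R : realType}.

Lemma partial_sum1E (u w : nat -> quat R) : w 0%N = 0 ->
  (forall n, (0 < n)%N -> w n = u n) -> partial_sum 1 u = series w.
Proof.
move=> w0 wu; apply/funext => -[|N]; rewrite /partial_sum /series /=.
  by rewrite !big_geq.
rewrite [RHS]big_ltn // w0 add0r; apply: eq_big_nat => n /andP[n0 _].
by rewrite wu.
Qed.

Lemma series_recl (F : nat -> quat R) N : F 0%N = 0 ->
  series F N.+1 = series (fun n => F n.+1) N.
Proof. by move=> F0; rewrite /series /= big_nat_recl // F0 add0r. Qed.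

(** On the real axis the principal part is a power series in [(x - p)^-1]; its chain rule factor is
    [- z^-1 ^+ 2]. *)
Lemma shell_derive (p : quat R) (f : quat R -> quat R) (a : int -> quat R)
    (R1 R2 : \bar R) (x : R) :
  (0 < R1)%E -> Omega_shell p R1 R2 x%:A ->
  cvg_abs_unif_on_compacts 0
    (fun n q => starX q p n * a n%:Z) (Omega_shell p R1 R2) ->
  cvg_abs_unif_on_compacts 1
    (fun n q => starV q p n * a (- n%:Z)) (Omega_shell p R1 R2) ->
  (forall q, Omega_shell p R1 R2 q ->
    f q = series_sum 0 (fun n => starX q p n * a n%:Z)
        + series_sum 1 (fun n => starV q p n * a (- n%:Z))) ->
  let z : quat R := x%:A - p in
  let Dp : nat -> quat R := fun n => (z ^+ n.-1 *+ n) * a n%:Z in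
  let Dn : nat -> quat R := fun n =>
    (z^-1 ^+ n.-1 *+ n) * (if n == 0%N then 0 else a (- n%:Z)) in
  [/\ z != 0, cvgn (series Dp), cvgn (series Dn) &
      'D_(qbasis 0) f x%:A = limn (series Dp) - z^-1 ^+ 2 * limn (series Dn)].
Proof.
move=> R10 Sx cp cn fE z Dp Dn.
(* A zero coefficient at index 0 turns the sum starting at 1 into an ordinary [series]. *)
pose c (n : nat) : quat R := if n == 0%N then 0 else a (- n%:Z).
have [I [p0 [p1 [SI pE xann]]]] := shell_real _ _ _ _ Sx.
have /andP[R1x _] := xann.
have z0 : z != 0.
  by rewrite -qabs_eq0 gt_eqF // -lte_fin; exact: lt_trans R1x.
have zpos : 0 < qabs z by rewrite lt_def qabs_eq0 z0 qabs_ge0.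
have cpl : complex_plane I p by exists p0, p1.
(* Moving from [x] along the line through [p] inside the slice of [p]: towards
   [p] ([t > 0]) and away from it ([t < 0]), while the conjugate point
   ([e = -1]) stays in the annulus.  Absolute convergence at these two points
   gives the geometric domination of the differentiated series; moving along
   the real axis would not do when [x] is the real part of [p]. *)
pose pt (e t : R) : quat R := (x + t * (p0 - x))%:A + (e * (t * p1)) *: I.
have ptE e t : pt e t = t *: ((p0 - x)%:A + (e * p1) *: I) + x%:A.
  by rewrite /pt scalerDr !scalerA mulrCA scalerDl [RHS]addrC addrA.
have nearann e : \forall t \near (0 : R), (R1 < (qabs (pt e t - p))%:E < R2)%E.
  have := near_line _ _ _ ((p0 - x)%:A + (e * p1) *: I) (annulus_near _ _ _ _ xann).
  by apply: filterS => t; rewrite ptE.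
have n1 := nearann 1; have n2 := nearann (-1).
have nearS : \forall t \near (0 : R), Omega_shell p R1 R2 (pt 1 t).
  apply: filterS2 n1 n2 => t h1 h2.
  rewrite /pt mul1r in h1 *; rewrite /pt mulN1r scaleNr in h2.
  exact: shell_plane.
have pt_sub t : pt 1 t - p = (1 - t) *: z.
  have vE : (p0 - x)%:A + p1 *: I = - z by rewrite /z pE opprB scalerBl addrAC.
  by rewrite ptE mul1r vE -addrA scalerN [RHS]scalerBl scale1r addrC.
have pt_comm t : GRing.comm (pt 1 t) p by rewrite pE; exact: plane_comm.
(* By [pt_sub] the points for [- s] and [s] are at distances [(1 + s) * qabs z] and
   [(1 - s) * qabs z] from [p]. The larger radius dominates the regular part, the inverse of the
   smaller one the principal part; [s < 1] keeps the latter radius positive. *)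
have [s [s0 s1 Sps Sns]] : exists s : R, [/\ 0 < s, s < 1,
    Omega_shell p R1 R2 (pt 1 s) & Omega_shell p R1 R2 (pt 1 (- s))].
  move/nbhs_ballP : nearS => [e /= e0 be].
  pose s : R := Num.min e 1 / 2.
  have m0 : 0 < Num.min e 1 by rewrite lt_min e0 ltr01.
  have s0 : 0 < s by rewrite divr_gt0.
  have sm : s < Num.min e 1 by rewrite ltr_pdivrMr // ltr_pMr // ltr1n.
  have [se s1] : s < e /\ s < 1 by move: sm; rewrite lt_min => /andP.
  by exists s; split=> //; apply: be; rewrite /ball /= sub0r ?opprK ?normrN gtr0_norm.
have cvgP : cvgn (series (fun n => (qabs (pt 1 (- s) - p)) ^+ n * qabs (a n%:Z))).
  have [+ _] := cvg_abs_unif_at _ _ _ _ cp Sns.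
  by under eq_fun do under eq_bigr do rewrite starX_comm // qabsM qabsX.
have cvgN : cvgn (series (fun n => (qabs (pt 1 s - p))^-1 ^+ n * qabs (c n))).
  have [+ _] := cvg_abs_unif_at _ _ _ _ cn Sps.
  have mm := shell_qmin _ _ _ _ R10 Sps.
  have -> : (fun N => \sum_(1 <= n < N) qabs (starV (pt 1 s) p n * a (- n%:Z))) =
      series (fun n => (qabs (pt 1 s - p))^-1 ^+ n * qabs (c n)); last by [].
  apply/funext => -[|N]; rewrite /series /=; first by rewrite !big_geq.
  rewrite [RHS]big_ltn // /c /= qabs0 mulr0 add0r; apply: eq_big_nat => n /andP[n0 _].
  by rewrite starV_comm // qabsM qabsX qabsV gtn_eqF.
have nearR : \forall h \near (0 : R)^', Omega_shell p R1 R2 (h + x)%:A.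
  have : \forall h \near (0 : R), (R1 < (qabs ((h + x)%:A - p : quat R))%:E < R2)%E.
    have := near_line _ _ _ (1 : quat R) (annulus_near _ _ _ _ xann).
    by apply: filterS => t; rewrite -scalerDl.
  move=> /nbhs_dnbhs; apply: filterS => h hh.
  rewrite -[(h + x)%:A]addr0 -[0](scale0r I); apply: shell_plane => //.
    by rewrite scale0r addr0.
  by rewrite scale0r subr0.
pose Z (h : R) : quat R := (h + x)%:A - p.
have Zz : Z h @[h --> (0 : R)^'] --> z.
  apply: cvgB; last exact: cvg_cst.
  apply: cvgZr_tmp; rewrite -[X in _ --> X]add0r; apply: cvgD; last exact: cvg_cst.
  by move=> A; exact: nbhs_dnbhs.
have Zsub h : Z h - z = h%:A by rewrite /Z /z opprB addrA subrK -scalerBl addrK.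
have commZ h k : GRing.comm (Z h) (Z k).
  apply: commrB; apply: commr_sym; first exact: comm_real.
  by apply: commrB; [exact/commr_sym/comm_real|exact: commr_refl].
have zE : z = Z 0 by rewrite /Z add0r.
have sZ h : series (fun n => starX (h + x)%:A p n * a n%:Z) =
            series (fun n => Z h ^+ n * a n%:Z).
  congr series; apply/funext => n; rewrite starX_comm //; exact: comm_real.
have sV h : Omega_shell p R1 R2 (h + x)%:A ->
    partial_sum 1 (fun n => starV (h + x)%:A p n * a (- n%:Z)) =
    series (fun n => (Z h)^-1 ^+ n * c n).
  move=> Sh; apply: partial_sum1E; first by rewrite mulr0.
  move=> n n0; rewrite starV_comm ?(shell_qmin _ _ _ _ R10 Sh) //; last exact: comm_real.
  by rewrite /c gtn_eqF.
have Sx0 : Omega_shell p R1 R2 (0 + x)%:A by rewrite add0r.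
have cX h : Omega_shell p R1 R2 (h + x)%:A -> cvgn (series (fun n => Z h ^+ n * a n%:Z)).
  by move=> Sh; rewrite -sZ; have [] := cvg_abs_unif_at _ _ _ _ cp Sh.
have cV h : Omega_shell p R1 R2 (h + x)%:A -> cvgn (series (fun n => (Z h)^-1 ^+ n * c n)).
  by move=> Sh; rewrite -sV //; have [] := cvg_abs_unif_at _ _ _ _ cn Sh.
have f_near h : Omega_shell p R1 R2 (h + x)%:A ->
    f (h + x)%:A = limn (series (fun n => Z h ^+ n * a n%:Z)) +
                   limn (series (fun n => (Z h)^-1 ^+ n * c n)).
  by move=> Sh; rewrite fE // /series_sum -sZ -sV.
have f_quot h : Omega_shell p R1 R2 (h + x)%:A ->
    h^-1 *: (f (h *: qbasis 0 + x%:A) - f x%:A) =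
    h^-1 *: (limn (series (fun n => Z h ^+ n * a n%:Z)) -
             limn (series (fun n => z ^+ n * a n%:Z))) +
    h^-1 *: (limn (series (fun n => (Z h)^-1 ^+ n * c n)) -
             limn (series (fun n => z^-1 ^+ n * c n))).
  move=> Sh; rewrite -[qbasis 0]/(1 : quat R) -scalerDl (f_near _ Sh).
  have := f_near 0 Sx0; rewrite add0r -zE => ->.
  by rewrite -scalerDr opprD addrACA.
have Zn0 : \forall h \near (0 : R)^', Z h != 0 by exact: cvgr_neq0 Zz z0.
have Zz_ne h : h != 0 -> Z h != z.
  by move=> h0; rewrite -subr_eq0 Zsub scaler_eq0 (negbTE h0) oner_eq0.
have Zquot : h^-1 *: (Z h - z) @[h --> (0 : R)^'] --> (1 : quat R).
  apply: cvg_near_cst; near=> h; rewrite Zsub scalerA mulVf ?scale1r //.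
  by near: h; exact: nbhs_dnbhs_neq.
have ZVz : (Z h)^-1 @[h --> (0 : R)^'] --> z^-1 by exact: cvg_qinv Zz z0.
have ZVquot : h^-1 *: ((Z h)^-1 - z^-1) @[h --> (0 : R)^'] -->
    (-1 : quat R) * (z^-1 * z^-1).
  have l : (-1 : quat R) * ((Z h)^-1 * z^-1) @[h --> (0 : R)^'] -->
      (-1 : quat R) * (z^-1 * z^-1).
    apply: cvg_qmul; first exact: cvg_cst.
    apply: cvg_qmul; [exact: ZVz|exact: cvg_cst].
  apply: (near_eq_cvg_to _ _ _ _ _ _ l); near=> h.
  have h0 : h != 0 by near: h; exact: nbhs_dnbhs_neq.
  have Zh0 : Z h != 0 by near: h.
  have -> : (Z h)^-1 - z^-1 = - (h *: ((Z h)^-1 * z^-1)).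
    rewrite -[h *: _]mulr_algl -Zsub mulrBl mulrA divrr // mul1r mulrA.
    have -> : z * (Z h)^-1 = (Z h)^-1 * z by apply: commrV; rewrite zE; exact: commZ.
    by rewrite -[(Z h)^-1 * z * _]mulrA divrr // mulr1 opprB.
  by rewrite scalerN scalerA mulVf // scale1r mulN1r.
have [cDp dDp] : cvgn (series Dp) /\
    (h^-1 *: (limn (series (fun n => Z h ^+ n * a n%:Z)) -
              limn (series (fun n => z ^+ n * a n%:Z)))) @[h --> (0 : R)^'] -->
    1 * limn (series Dp).
  apply: (cvg_qpowser_derive _ _ _ _ _ _ _ _ Zz Zquot _ _ _ _ cvgP).
  - near=> h; split; last by rewrite zE; exact: commZ.
    by apply: Zz_ne; near: h; exact: nbhs_dnbhs_neq.
  - near=> h; apply: cX; near: h; exact: nearR.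
  - by rewrite zE; exact: cX.
  - have sp : 0 < 1 + s by rewrite addr_gt0.
    by rewrite pt_sub qabsZ opprK (gtr0_norm sp) ltr_pMl // ltrDl.
have [cDn dDn] : cvgn (series Dn) /\
    (h^-1 *: (limn (series (fun n => (Z h)^-1 ^+ n * c n)) -
              limn (series (fun n => z^-1 ^+ n * c n)))) @[h --> (0 : R)^'] -->
    (-1 : quat R) * (z^-1 * z^-1) * limn (series Dn).
  apply: (cvg_qpowser_derive _ _ _ _ _ _ _ _ ZVz ZVquot _ _ _ _ cvgN).
  - near=> h; split; last first.
      by rewrite zE; apply: commrV; apply: commr_sym; apply: commrV; exact: commZ.
    rewrite (inj_eq invr_inj); apply: Zz_ne; near: h; exact: nbhs_dnbhs_neq.
  - near=> h; apply: cV; near: h; exact: nearR.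
  - by rewrite zE; exact: cV.
  - have sp : 0 < 1 - s by rewrite subr_gt0.
    apply: (@le_lt_trans _ _ (qabs z)^-1); first by rewrite -qabsV.
    rewrite pt_sub qabsZ (gtr0_norm sp) ltf_pV2 ?posrE ?mulr_gt0 //.
    by rewrite gtr_pMl // gtrBl.
have fd : is_derive (x%:A : quat R) (qbasis 0) f ((1 : quat R) * limn (series Dp) +
    (-1 : quat R) * (z^-1 * z^-1) * limn (series Dn)).
  apply/is_derive_cvg; apply: (near_eq_cvg_to _ _ _ _ _ _ (cvgD dDp dDn)); near=> h.
  by apply/esym/f_quot; near: h; exact: nearR.
have [_ ->] := fd.
by split=> //; rewrite expr2 mul1r mulN1r mulNr.
Unshelve. all: by end_near. Qed.

End LaurentFueter.

(** * Assembling the expansion of the Fueter derivative *)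

Lemma qim_eq0 (R : realType) (q : quat R) : qim q = 0 -> q = (qre q)%:A.
Proof. by move=> q0; rewrite {1}[q]qre_imE q0 addr0. Qed.

Theorem theorem6p5 (R : realType) (Omega : set (quat R))
    (f : quat R -> quat R) (p : quat R) (a b : int -> quat R)
    (R1 R2 : \bar R)
    (Omega_open : open Omega)
    (Omega_axsym : axially_symmetric Omega)
    (f_slice : left_slice_hyperholomorphic Omega f)
    (R2E : (R2^-1)%E = root_limsup (fun n : nat => a n%:Z))
    (R1E : R1 = root_limsup (fun n : nat => a (- n%:Z)))
    (R1_gt0 : (0 < R1)%E) (R1_lt_R2 : (R1 < R2)%E)
    (shell_neq0 : Omega_shell p R1 R2 !=set0)
    (shell_sub : Omega_shell p R1 R2 `<=` Omega)
    (cvg_pos : cvg_abs_unif_on_compacts 0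
       (fun n q => starX q p n * a n%:Z) (Omega_shell p R1 R2))
    (cvg_neg : cvg_abs_unif_on_compacts 1
       (fun n q => starV q p n * a (- n%:Z)) (Omega_shell p R1 R2))
    (f_laurent : forall q, Omega_shell p R1 R2 q ->
       f q = series_sum 0 (fun n => starX q p n * a n%:Z)
           + series_sum 1 (fun n => starV q p n * a (- n%:Z)))
    (b_pos : forall n : nat, b n%:Z = (- (2 * n.+1%:R)) *: a n.+1%:Z)
    (b_neg : forall n : nat, (1 <= n)%N -> b (- n%:Z) = 2 *: a (- n%:Z)) :
  forall q, Omega_shell p R1 R2 q ->
    let u n := Htilde n q p * b n%:Z in
    let v n := Hcal n q p * QcV p n q * b (- n%:Z) in
    [/\ fueter_derivable f q,
        cvgn (partial_sum 0 u),
        cvgn (partial_sum 1 v) &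
        fueter f q = series_sum 0 u + series_sum 1 v].
Proof.
move=> q Sq u v.
have Oq := shell_sub _ Sq.
have uE n : u n = -2 *: ((\sum_(1 <= k < n.+2) starXconj q p (n.+1 - k) (k - 1)) * a n.+1%:Z).
  by rewrite /u b_pos mulr_Htilde.
have vE n : (0 < n)%N -> v n = 2 *: (Hcal n q p * QcV p n q * a (- n%:Z)).
  by move=> n0; rewrite /v b_neg // -scalerAr.
have [imq|imq] := eqVneq (qim q) 0.
  pose x := qre q.
  have qx : q = x%:A by exact: qim_eq0.
  have Sx : Omega_shell p R1 R2 x%:A by rewrite -qx.
  have [z0 cDp cDn DE] := shell_derive _ _ _ _ _ _ R1_gt0 Sx cvg_pos cvg_neg f_laurent.
  set z := x%:A - p in z0 cDp cDn DE.
  set Dp := (fun n : nat => _) in cDp DE; set Dn := (fun n : nat => _) in cDn DE.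
  have Ox : Omega x%:A by rewrite -qx.
  have [df fE] := slice_fueter_real _ _ _ Omega_open Omega_axsym f_slice Ox.
  (* The shift by one reflects that [b n] involves [a n.+1]; the term of [Dp] of index 0
     vanishes. *)
  have pu : partial_sum 0 u = (fun N => -2 *: series Dp N.+1).
    apply/funext => N; rewrite series_recl; last by rewrite /Dp mulr0n mul0r.
    rewrite /partial_sum /series /= scaler_sumr; apply: eq_bigr => n _.
    by rewrite uE qx sum_starXconj_real.
  have pv : partial_sum 1 v = (fun N => 2 *: (z^-1 ^+ 2 * series Dn N)).
    rewrite (partial_sum1E _ (fun n => 2 *: (z^-1 ^+ 2 * Dn n))); first last.
    - move=> n n0; rewrite vE // qx Hcal_QcV_real; last by rewrite -subr_eq0.
      rewrite /Dn gtn_eqF // -/z.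
      by rewrite -!mulrA.
    - by rewrite /Dn mulr0n mul0r mulr0 scaler0.
    by apply/funext => N; rewrite /series /= mulr_sumr scaler_sumr.
  have lu : partial_sum 0 u @ \oo --> -2 *: limn (series Dp).
    rewrite pu; apply: cvgZl_tmp.
    by rewrite (@cvg_shiftS _ (series Dp)); exact: cDp.
  have lv : partial_sum 1 v @ \oo --> 2 *: (z^-1 ^+ 2 * limn (series Dn)).
    by rewrite pv; apply: cvgZl_tmp; apply: cvg_qmul; [exact: cvg_cst|exact: cDn].
  split; [by rewrite qx|exact: cvgP lu|exact: cvgP lv|].
  rewrite /series_sum (cvg_lim _ lu) // (cvg_lim _ lv) //.
  by rewrite qx fE DE scalerBr scaleNr [X in _ - X]scaleNr opprK.
have [df fE] := slice_fueter_nonreal _ _ _ Omega_open Omega_axsym f_slice Oq imq.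
have Sc := shell_conj _ _ _ _ Sq.
have m1 := shell_qmin _ _ _ _ R1_gt0 Sq; have m2 := shell_qmin _ _ _ _ R1_gt0 Sc.
pose w := q - qconj q.
have w0 : w != 0.
  have -> : w = 2 *: qim q by apply: quatP; split; rewrite !mxE /=; ring.
  by rewrite scaler_eq0 pnatr_eq0.
pose sp (r : quat R) (n : nat) := starX r p n * a n%:Z.
pose sn (r : quat R) (n : nat) := starV r p n * a (- n%:Z).
have [_ cpq] := cvg_abs_unif_at _ _ _ _ cvg_pos Sq.
have [_ cpc] := cvg_abs_unif_at _ _ _ _ cvg_pos Sc.
have [_ cnq] := cvg_abs_unif_at _ _ _ _ cvg_neg Sq.
have [_ cnc] := cvg_abs_unif_at _ _ _ _ cvg_neg Sc.
(* The terms of index 0 at [q] and [qconj q] both equal [a 0] and cancel, hence the shift to [N.+1];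
   the others are divided by [w] through [starX_subconj]. *)
have pu : partial_sum 0 u = (fun N =>
    -2 *: (w^-1 * (partial_sum 0 (sp q) N.+1 - partial_sum 0 (sp (qconj q)) N.+1))).
  apply/funext => N; rewrite /partial_sum -sumrB big_nat_recl //.
  rewrite [X in X + _](_ : _ = 0) ?add0r; last first.
    by rewrite /sp -mulrBl !starXE subrr mul0r.
  rewrite mulr_sumr scaler_sumr; apply: eq_bigr => n _.
  by rewrite uE /sp -mulrBl starX_subconj -/w !mulrA mulVr // mul1r.
(* The minus sign in [starV_subconj] reconciles the common factor [-2] with the coefficient [2] of
   [b (- n%:Z)]. *)
have pv : partial_sum 1 v = (fun N =>
    -2 *: (w^-1 * (partial_sum 1 (sn q) N - partial_sum 1 (sn (qconj q)) N))).
  apply/funext => N; rewrite /partial_sum -sumrB mulr_sumr scaler_sumr.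
  apply: eq_big_nat => n /andP[n0 _].
  rewrite vE // /sn -mulrBl starV_subconj // -/w !mulNr mulrN scaleNr scalerN opprK.
  by rewrite !mulrA mulVr // mul1r.
have lu : partial_sum 0 u @ \oo --> -2 *: (w^-1 *
    (series_sum 0 (sp q) - series_sum 0 (sp (qconj q)))).
  rewrite pu; apply: cvgZl_tmp; apply: cvg_qmul; first exact: cvg_cst.
  rewrite (@cvg_shiftS _ (fun N => partial_sum 0 (sp q) N - partial_sum 0 (sp (qconj q)) N)).
  exact: cvgB cpq cpc.
have lv : partial_sum 1 v @ \oo --> -2 *: (w^-1 *
    (series_sum 1 (sn q) - series_sum 1 (sn (qconj q)))).
  rewrite pv; apply: cvgZl_tmp; apply: cvg_qmul; first exact: cvg_cst.
  exact: cvgB cnq cnc.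
split; [by []|exact: cvgP lu|exact: cvgP lv|].
have -> : series_sum 0 u = _ := cvg_lim (@norm_hausdorff _ _) lu.
have -> : series_sum 1 v = _ := cvg_lim (@norm_hausdorff _ _) lv.
have -> : fueter f q = w^-1 * (w * fueter f q) by rewrite mulrA mulVr // mul1r.
rewrite /w fE -/w (f_laurent _ Sq) (f_laurent _ Sc) -scalerAr -scalerDr -mulrDr.
have E (s t c d : quat R) : s + t - (c + d) = s - c + (t - d) by rewrite opprD addrACA.
exact: (congr1 (fun y => -2 *: (w^-1 * y)) (E _ _ _ _)).
Qed.
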